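(* Let $F_1$ and $F_2$ be two Finsler structures on a smooth manifold $M$ and let $t\in[0,1]$. Assume that for every $x,y\in M$ there exists an absolutely continuous path $\gamma_{x,y}\colon[0,1]\to M$ joining $x$ to $y$ with the following properties: (1) $\gamma_{x,y}$ is a geodesic from $x$ to $y$ with respect to both $F_1$ and $F_2$; (2) the function $s\mapsto (1-t)F_1(\gamma_{x,y}(s),\dot\gamma_{x,y}(s))-tF_2(\gamma_{x,y}(s),\dot\gamma_{x,y}(s))$ on $[0,1]$ does not change sign, that is, it is either non-negative for almost all $s\in[0,1]$ or non-positive for almost all $s\in[0,1]$. Then the metric $\max\{(1-t)d(F_1),\,t\,d(F_2)\}$ is a Finsler metric with Lagrangian $\max\{(1-t)F_1,\,tF_2\}$; that is, $d(\max\{(1-t)F_1,tF_2\})=\max\{(1-t)d(F_1),t\,d(F_2)\}$. Furthermore, for all $x,y\in M$, $\gamma_{x,y}$ is a geodesic with respect to the Finsler metric $\max\{(1-t)d(F_1),\,t\,d(F_2)\}$.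
   Context: A Finsler structure on a smooth manifold $M$ is a continuous function $F\colon TM\to[0,\infty)$ such that for every $x\in M$ the restriction $F(x,\cdot)$ to $T_xM$ is a weak norm, i.e. $F(x,v_1+v_2)\le F(x,v_1)+F(x,v_2)$ for all $v_1,v_2\in T_xM$; $F(x,\lambda v)=\lambda F(x,v)$ for all $\lambda\ge 0$ and $v\in T_xM$; and $F(x,v)=0$ if and only if $v=0$. (No symmetry and no further regularity is assumed.) The length of a piecewise $C^1$-path $\beta\colon[a,b]\to M$ is $l_F(\beta)=\int_a^bF(\beta(s),\dot\beta(s))\,ds$. The induced (possibly non-symmetric) metric $d(F)(x,y)$ is the infimum of $l_F(\beta)$ over all piecewise $C^1$-paths $\beta$ from $x$ to $y$. A metric on $M$ is Finsler with Lagrangian $G$ if it equals $d(G)$ for the Finsler structure $G$. For a continuous path $\gamma\colon[a,b]\to M$, $l(d(F))(\gamma)$ is the supremum of $\sum_{i=0}^n d(F)(\gamma(t_i),\gamma(t_{i+1}))$ over all finite partitions $a=t_0\le t_1\le\dots\le t_{n+1}=b$. The path is a geodesic with respect to $F$ (or with respect to the metric $d(F)$) if it is continuous, $l(d(F))(\gamma)<\infty$ and $l(d(F))(\gamma)=d(F)(\gamma(a),\gamma(b))$. A path $\gamma\colon[a,b]\to M$ is absolutely continuous if, for the distance $d$ of a Riemannian metric on $M$ (the notion does not depend on its choice), for every $\epsilon>0$ there is $\delta>0$ such that for any disjoint intervals $(a_1,b_1),\dots,(a_n,b_n)$ in $[a,b]$ of total length less than $\delta$ one has $\sum_i d(\gamma(a_i),\gamma(b_i))<\epsilon$.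 Such a path has a derivative $\dot\gamma(s)$ for almost every $s$. $(\max\{(1-t)F_1,tF_2\})(x,v)=\max\{(1-t)F_1(x,v),tF_2(x,v)\}$, which is again a Finsler structure. *)

(* Defs.v *)
From HB Require Import structures.
From mathcomp Require Import all_boot all_order all_algebra.
From mathcomp Require Import all_classical all_reals all_analysis.

Set Implicit Arguments.
Unset Strict Implicit.
Unset Printing Implicit Defensive.

Import Order.TTheory GRing.Theory Num.Theory.
Import numFieldNormedType.Exports.

Local Open Scope classical_set_scope.
Local Open Scope ring_scope.

(* [U] is meant to be open and [V] finite-dimensional: under these conditions
   the derivative is of class C^k iff all directional derivatives are. *)
Fixpoint Ck_on (R : realType) (V W : normedModType R) (k : nat) (U : set V)
    (f : V -> W) : Prop :=
  match k with
  | 0%N => {in U, continuous f}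
  | k'.+1 => {in U, forall x, differentiable f x} /\
             forall v : V, Ck_on k' U ('D_v f)
  end.

Definition smooth_on (R : realType) (V W : normedModType R) (U : set V)
    (f : V -> W) : Prop :=
  forall k, Ck_on k U f.

(* The smooth structure is given by an atlas, not necessarily maximal; nothing
   below depends on the choice of a compatible atlas. [chart i] and [chartV i]
   are only meaningful on [dom i] and on [chart i @` dom i] respectively. *)
Record smoothManifold (R : realType) (n : nat) := SmoothManifold {
  carrier :> topologicalType;
  carrier_hausdorff : hausdorff_space carrier;
  carrier_second_countable : @second_countable carrier;
  chart_index : Type;
  dom : chart_index -> set carrier;
  chart : chart_index -> carrier -> 'rV[R]_n;
  chartV : chart_index -> 'rV[R]_n -> carrier;
  dom_open : forall i, open (dom i);
  dom_cover : \bigcup_i dom i = [set: carrier];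
  chart_image_open : forall i, open (chart i @` dom i);
  chart_continuous : forall i, {in dom i, continuous (chart i)};
  chartV_continuous : forall i, {in chart i @` dom i, continuous (chartV i)};
  chartK : forall i, {in dom i, cancel (chart i) (chartV i)};
  transition_smooth : forall i j,
    smooth_on (chart i @` (dom i `&` dom j)) (chart j \o chartV i)
}.

Section Tangent.
Context (R : realType) (n : nat) (M : smoothManifold R n).
Implicit Types (x : M) (i j : chart_index M).

(* A tangent vector at [x] is the family of its coordinate vectors in all the
   charts around [x]; these are exchanged by the differentials of the
   transition maps. The component at a chart whose domain does not contain [x]
   is set to 0, so that equality of tangent vectors is equality of families; the vector
   space structure is the pointwise one. *)
Definition tangent x : set (chart_index M -> 'rV[R]_n) :=
  [set v | (forall i, ~ dom i x -> v i = 0) /\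
           (forall i j, dom i x -> dom j x ->
              v j = 'd (chart j \o chartV i) (chart i x) (v i))].

(* For [x] in [dom i], the tangent vector at [x] with coordinates [w] in the
   chart [i]. *)
Definition tvec i x (w : 'rV[R]_n) : chart_index M -> 'rV[R]_n :=
  fun j => if x \in dom j then 'd (chart j \o chartV i) (chart i x) w else 0.

Definition velocity (gamma : R -> M) (s : R) : chart_index M -> 'rV[R]_n :=
  fun i => if gamma s \in dom i then derive1 (chart i \o gamma) s else 0.

End Tangent.

Section Finsler.
Context (R : realType) (n : nat) (M : smoothManifold R n).
Local Notation vec := (chart_index M -> 'rV[R]_n).
Implicit Types (F : M -> vec -> R) (d : M -> M -> \bar R) (x y : M) (a b : R).

(* A function on the tangent bundle is represented by [F : M -> vec -> R], of
   which only the values [F x v] with [v] tangent at [x] matter. Continuity is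
   for the topology of the tangent bundle, in which the bijections
   (x, w) |-> tvec i x w from dom i x R^n are homeomorphisms onto open sets
   that cover the bundle. *)
Record finsler_structure F : Prop := FinslerStructure {
  finsler_continuous : forall i : chart_index M,
    {in dom i `*` [set: 'rV[R]_n],
      continuous (fun p : M * 'rV[R]_n => F p.1 (tvec i p.1 p.2))};
  finsler_ge0 : forall x v, tangent x v -> 0 <= F x v;
  finsler_subadditive : forall x v1 v2, tangent x v1 -> tangent x v2 ->
    F x (v1 + v2) <= F x v1 + F x v2;
  finsler_homogeneous : forall x (lambda : R) v, 0 <= lambda -> tangent x v ->
    F x (lambda *: v) = lambda * F x v;
  finsler_eq0 : forall x v, tangent x v -> (F x v = 0 <-> v = 0)
}.

(* Derivatives at [a] and [b] are one-sided, and [w] is the coordinate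
   expression of the derivative of [beta] in the chart [i]. *)
Definition C1_on a b (beta : R -> M) : Prop :=
  {within `[a, b], continuous beta} /\
  forall i : chart_index M, exists w : R -> 'rV[R]_n,
    {within `[a, b] `&` beta @^-1` dom i, continuous w} /\
    forall s, a <= s <= b -> dom i (beta s) ->
      (fun u => (u - s)^-1 *: (chart i (beta u) - chart i (beta s)))
        @ within `[a, b]%classic s^' --> w s.

Definition piecewise_C1 a b (beta : R -> M) : Prop :=
  exists (m : nat) (t : nat -> R),
    [/\ t 0%N = a, t m.+1 = b &
        forall k, (k <= m)%N -> t k < t k.+1 /\ C1_on (t k) (t k.+1) beta].

(* At the finitely many break points of a piecewise C^1 path [velocity] may be
   meaningless, which does not affect the integral. *)
Definition flength F a b (beta : R -> M) : \bar R :=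
  (\int[lebesgue_measure]_(s in `[a, b]) (F (beta s) (velocity beta s))%:E)%E.

(* The value is +oo when no piecewise C^1 path joins [x] to [y]. *)
Definition dist F x y : \bar R :=
  ereal_inf [set l | exists a b (beta : R -> M),
    [/\ a < b, piecewise_C1 a b beta, beta a = x, beta b = y &
        l = flength F a b beta]].

Definition metric_length d a b (gamma : R -> M) : \bar R :=
  ereal_sup [set l | exists (m : nat) (t : nat -> R),
    [/\ t 0%N = a, t m.+1 = b, forall k, (k <= m)%N -> t k <= t k.+1 &
        l = (\sum_(0 <= k < m.+1) d (gamma (t k)) (gamma (t k.+1)))%E]].

Definition geodesic d a b (gamma : R -> M) : Prop :=
  [/\ {within `[a, b], continuous gamma},
      (metric_length d a b gamma < +oo)%E &
      metric_length d a b gamma = d (gamma a) (gamma b)].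

Definition finsler_metric_with_lagrangian d F : Prop :=
  finsler_structure F /\ forall x y, d x y = dist F x y.

Record riemannian_metric (g : M -> vec -> vec -> R) : Prop :=
  RiemannianMetric {
  riemannian_sym : forall x u v, tangent x u -> tangent x v ->
    g x u v = g x v u;
  riemannian_linear : forall x (c : R) u v w,
    tangent x u -> tangent x v -> tangent x w ->
    g x (c *: u + v) w = c * g x u w + g x v w;
  riemannian_posdef : forall x v, tangent x v -> v <> 0 -> 0 < g x v v;
  riemannian_smooth : forall (i : chart_index M) (w1 w2 : 'rV[R]_n),
    smooth_on (chart i @` dom i)
      (fun u => g (chartV i u) (tvec i (chartV i u) w1)
                               (tvec i (chartV i u) w2) : R^o)
}.

Definition riemannian_dist (g : M -> vec -> vec -> R) : M -> M -> \bar R :=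
  dist (fun x v => Num.sqrt (g x v v)).

(* The notion does not depend on the Riemannian metric. *)
Definition absolutely_continuous a b (gamma : R -> M) : Prop :=
  exists2 g, riemannian_metric g &
  forall eps : R, 0 < eps -> exists2 delta : R, 0 < delta &
    forall (m : nat) (l r : 'I_m -> R),
      (forall k, [/\ a <= l k, l k < r k & r k <= b]) ->
      trivIset [set: 'I_m] (fun k => `]l k, r k[%classic) ->
      \sum_(k < m) (r k - l k) < delta ->
      (\sum_(k < m) riemannian_dist g (gamma (l k)) (gamma (r k)) < eps%:E)%E.

Definition max_lagrangian (t : R) F1 F2 : M -> vec -> R :=
  fun x v => Num.max ((1 - t) * F1 x v) (t * F2 x v).

Definition max_metric (t : R) d1 d2 : M -> M -> \bar R :=
  fun x y => maxe ((1 - t)%:E * d1 x y)%E (t%:E * d2 x y)%E.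

End Finsler.

(* Main.v *)
Require Import Defs.
From HB Require Import structures.
From mathcomp Require Import all_boot all_order all_algebra.
From mathcomp Require Import all_classical all_reals all_analysis.
From mathcomp Require Import measurable_realfun lra ring.

Set Implicit Arguments.
Unset Strict Implicit.
Unset Printing Implicit Defensive.

Import Order.TTheory GRing.Theory Num.Theory.
Import numFieldNormedType.Exports.

Local Open Scope classical_set_scope.
Local Open Scope ring_scope.

(* Write F for the maximum of (1 - t) F1 and t F2, and d, d1, d2 for the
   distances of F, F1, F2. The inequality d >= max((1 - t) d1, t d2) only uses
   F >= (1 - t) F1 and F >= t F2. For the converse, let gamma be the given path
   from x to y and say F = (1 - t) F1 along it for almost every s. Put
   f(s) = d(x, gamma s) and V(s) = (1 - t) times the d1-length of gamma on
   [0, s], so that V(1) - V(0) <= (1 - t) d1(x, y). Where gamma has a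
   derivative w (in a chart), appending a straight chart segment to a path from
   x to gamma(s) gives f(s + h) - f(s) <= h F(gamma s, w) + o(h), while
   V(s + h) - V(s) >= (1 - t) d1(gamma s, gamma(s + h))
                   >= (1 - t) h F1(gamma s, w) - o(h).
   Hence f - V has a nonpositive upper right Dini derivative almost everywhere;
   f is locally bounded by the variation of the absolutely continuous
   coordinates of gamma and V is nondecreasing, so f - V is nonincreasing.
   In this way neither the length of gamma as an integral nor the triangle
   inequality for the distances is ever needed. *)

(** * Dini inequalities and absolutely continuous functions *)

(** The two estimates at a point differ in nature. Appending a segment yields one competitor for an
    infimum, so the upper bound is direct. The lower bound must hold for every competitor, also for
    paths that leave the chart; it is obtained by applying the same Dini argument to a capped norm
    in the chart, which grows along any path at most as fast as the length. This lower bound is used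
    twice: for [F1] it is the first order estimate, and for a Riemannian norm it turns absolute
    continuity of [gamma], stated through a distance on [M], into absolute continuity of its
    coordinates. A Dini inequality that holds only almost everywhere does not give monotonicity, as
    the Cantor function shows. What excludes such behaviour is that the increments of f are
    dominated by those of an absolutely continuous function, whose Stieltjes measure is small on
    small open sets around the exceptional null set. Coordinates exist only near a point of the
    path, so all of this is local; real induction on the parameter carries it to the whole
    interval. *)

Section RealInduction.
Context (R : realType).
Implicit Types (a b s : R) (f V : R -> R).

(** Compactness of [[a, b]] in inductive form: the supremum of the initial segments on which [P]
    holds satisfies [P] by the left step, and by the right step it cannot lie below [b]. *)
Lemma real_induction a b (P : R -> Prop) : a <= b -> P a ->
  (forall s, a <= s < b -> P s -> exists2 d, 0 < d &
     forall s', s < s' < s + d -> s' <= b -> P s') ->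
  (forall s, a < s <= b -> (forall s', a <= s' < s -> P s') -> P s) ->
  P b.
Proof.
move=> ab Pa right left.
pose S := [set s | a <= s <= b /\ forall u, a <= u <= s -> P u].
have Sa : S a.
  split; first by rewrite lexx ab.
  by move=> u ?; have -> : u = a by lra.
have hS : has_sup S by split; [exists a|exists b => s -[/andP[]]].
have aS : a <= sup S by apply: ub_le_sup => //; case: hS.
have Sb : sup S <= b by apply: ge_sup; [exists a|move=> s [/andP[]]].
have lt u : a <= u < sup S -> P u.
  move=> /andP[au uS].
  have [s [_ +] us] := sup_adherent (eps := sup S - u) ltac:(lra) hS.
  by apply; lra.
have PS : P (sup S).
  have [<-//|aS'] := eqVneq a (sup S).
  by apply: left => //; rewrite Sb lt_neqAle aS' aS.
have [<-//|Sb'] := eqVneq (sup S) b.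
have {}Sb : sup S < b by rewrite lt_neqAle Sb' Sb.
have [||d d0 Hd] := right (sup S) => //; first by rewrite aS Sb.
pose m := Num.min (sup S + d / 2) b.
have m1 : sup S < m by rewrite lt_min Sb andbT; lra.
have m2 : m <= sup S + d / 2 by rewrite ge_min lexx.
have m3 : m <= b by rewrite ge_min lexx orbT.
suff : S m by move=> /(ub_le_sup hS.2); lra.
split=> [|u /andP[au um]]; first by rewrite m3 andbT; lra.
have [uS|uS|->//] := ltgtP u (sup S).
  by apply: lt; rewrite au uS.
by apply: Hd; lra.
Qed.

(** Real induction on the inequality with slack [e * (s - a)]. Passing to a limit from the left only
    requires that [f] does not jump up there and that [V] is monotone. Neither function has to be
    continuous: later [f] is a lower semicontinuous capped norm along a path, or [V] is a length
    function. *)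
Lemma dini_le a b f V : a <= b ->
  (forall s, a < s <= b -> forall e, 0 < e -> exists2 d, 0 < d &
     forall s', s - d < s' < s -> a <= s' -> f s <= f s' + e) ->
  (forall x y, a <= x -> x <= y -> y <= b -> V x <= V y) ->
  (forall s, a <= s < b -> forall e, 0 < e -> exists2 d, 0 < d &
     forall s', s < s' < s + d -> s' <= b ->
       f s' - f s <= V s' - V s + e * (s' - s)) ->
  f b - f a <= V b - V a.
Proof.
move=> ab left Vmono right.
suff H e : 0 < e -> f b - f a <= V b - V a + e * (b - a).
  apply/ler_addgt0Pr => e e0.
  (* The [+ 1] covers the case [a = b]. *)
  have p : 0 < b - a + 1 by lra.
  have := H (e / (b - a + 1)) ltac:(exact: divr_gt0); move/le_trans; apply.
  by rewrite lerD2l mulrAC ler_pdivrMr// ler_pM2l//; lra.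
move=> e0.
pose P s := f s - f a <= V s - V a + e * (s - a).
apply: (@real_induction a b P) => //.
- by rewrite /P !subrr mulr0 addr0.
- move=> s sab Ps; have [d d0 Hd] := right _ sab _ e0.
  exists d => // s' s's s'b; have := Hd _ s's s'b; move: Ps; rewrite /P.
  by lra.
- move=> s sab IH; rewrite /P; apply/ler_addgt0Pr => eta eta0.
  have [d d0 Hd] := left _ sab _ eta0.
  pose u := Num.max a (s - d / 2).
  have u1 : a <= u by rewrite le_max lexx.
  have u2 : s - d / 2 <= u by rewrite le_max lexx orbT.
  have u3 : u < s by rewrite gt_max; lra.
  have /Hd/(_ u1) H1 : s - d < u < s by rewrite u3 andbT; lra.
  have : P u by apply: IH; rewrite u1 u3.
  rewrite /P => Pu.
  have V1 := Vmono u s u1 (ltW u3) ltac:(lra).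
  have : e * (u - a) <= e * (s - a) by rewrite ler_pM2l//; lra.
  by lra.
Qed.

End RealInduction.

(** * Absolutely continuous functions and their total variation *)

Section AbsoluteContinuity.
Context (R : realType).
Implicit Types (a b c e d : R) (f : R -> R) (s : seq (R * R)).
Local Notation TV := total_variation.

(** Degenerate intervals and common end points are allowed, so that partitions, and images of chains
    under nondecreasing maps, are again chains. *)
Definition chain s :=
  all (fun x => x.1 <= x.2) s && pairwise (fun x y => x.2 <= y.1) s.

Definition total_length s := \sum_(x <- s) (x.2 - x.1).

Definition total_increment f s := \sum_(x <- s) `|f x.2 - f x.1|.

(** Stated on the whole line: a function given on an interval is first composed with a retraction
    onto it, which spares all end point conditions. *)
Definition abs_cont f := forall e, 0 < e -> exists2 d, 0 < d &
  forall s, chain s -> total_length s < d -> total_increment f s <= e.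

Lemma chain_cons x s : chain (x :: s) =
  [&& x.1 <= x.2, all (fun y => x.2 <= y.1) s & chain s].
Proof.
rewrite /chain /=; case: (x.1 <= x.2) => //=.
by rewrite andbCA.
Qed.

Lemma chain_cat s1 s2 : chain (s1 ++ s2) =
  [&& chain s1, chain s2 & allrel (fun x y => x.2 <= y.1) s1 s2].
Proof.
rewrite /chain all_cat pairwise_cat.
rewrite -!andbA; do !bool_congr.
Qed.

Lemma chain_partition a (p : seq R) : path <%R a p ->
  [/\ chain (zip (a :: p) p),
      all (fun x => (a <= x.1) && (x.2 <= last a p)) (zip (a :: p) p) &
      total_length (zip (a :: p) p) = last a p - a].
Proof.
elim: p a => [|x p IH] a /=; first by rewrite /total_length big_nil subrr.
move=> /andP[ax xp]; have [ch al len] := IH _ xp; split.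
- rewrite chain_cons /= (ltW ax) ch andbT /=.
  by apply: sub_all al => y /andP[].
- rewrite lexx /= (@itv_partition_le _ _ x _ p)//=.
  by apply: sub_all al => y /andP[xy ->]; rewrite andbT (le_trans _ xy)// ltW.
- by rewrite /total_length big_cons -/(total_length _) len /=; lra.
Qed.

Lemma total_increment_partition f a b (p : seq R) : itv_partition a b p ->
  total_increment f (zip (a :: p) p) = variation a b f p.
Proof.
move=> /variation_zip ->; rewrite /total_increment.
elim: p a => [|x p IH] a /=; first by rewrite !big_nil.
by rewrite !big_cons /= IH.
Qed.

(** Each interval is cut by a partition that attains its variation up to [eta]. The total length is
    unchanged, so the [d] of absolute continuity still applies to the refinement. The clause on
    lower bounds [c] is the induction invariant that keeps the refined tail to the right of the
    head. *)
Lemma variation_refinement f eta s : 0 < eta -> chain s ->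
  (forall x, x \in s -> TV x.1 x.2 f \is a fin_num) ->
  exists s', [/\ chain s',
    forall c, all (fun x => c <= x.1) s -> all (fun x => c <= x.1) s',
    total_length s' = total_length s &
    \sum_(x <- s) fine (TV x.1 x.2 f) <=
      total_increment f s' + eta * (size s)%:R].
Proof.
move=> eta0; elim: s => [|x s IH].
  by move=> _ _; exists [::]; rewrite /total_increment !big_nil mulr0 addr0.
rewrite chain_cons => /and3P[x12 xs chs] fin.
have {IH}[|s' [chs' low len le]] := IH chs.
  by move=> y ys; apply: fin; rewrite inE ys orbT.
have finx : TV x.1 x.2 f \is a fin_num by apply: fin; rewrite inE eqxx.
have [_ [_ [p xp <-] <-]] := ub_ereal_sup_adherent eta0 finx.
rewrite -/(TV x.1 x.2 f) -(fineK finx) -EFinB lte_fin => ltp.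
have [pp /eqP lastp] := xp.
have [chz bz lz] := chain_partition pp.
exists (zip (x.1 :: p) p ++ s'); split.
- rewrite chain_cat chz chs' /=; apply/allrelP => y z yz zs'.
  have /andP[_] := allP bz _ yz; rewrite lastp => /le_trans; apply.
  by have /allP := low _ xs; apply.
- move=> c /= /andP[cx cs]; rewrite all_cat low// andbT.
  by apply: sub_all bz => y /andP[+ _]; apply: le_trans.
- by rewrite /total_length big_cat big_cons/= -!/(total_length _) lz len lastp.
- rewrite big_cons /total_increment big_cat/= -!/(total_increment _ _).
  rewrite (total_increment_partition _ xp).
  by rewrite -natr1 mulrDr mulr1; lra.
Qed.

(** Every partition of an interval shorter than the [d] belonging to [1] is a chain of total length
    below [d], so the variation there is at most 1; real induction strings such intervals
    together. *)
Lemma abs_cont_total_variation_lty f a b : abs_cont f -> a <= b ->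
  TV a b f \is a fin_num.
Proof.
move=> acf ab; have [d d0 Hd] := acf _ ltr01.
have small x y : x <= y -> y - x < d -> TV x y f \is a fin_num.
  move=> xy xyd; rewrite ge0_fin_numE ?total_variation_ge0//.
  apply: le_lt_trans (ltry 1); apply: ge_ereal_sup => _ [_ [p xp <-] <-].
  rewrite lee_fin -(total_increment_partition _ xp).
  have [pp /eqP lastp] := xp; have [chz _ lz] := chain_partition pp.
  by apply: Hd => //; rewrite lz lastp.
pose P (x : R) : Prop := TV a x f \is a fin_num; rewrite -/(P b).
apply: (real_induction ab); rewrite /P.
- by rewrite total_variationxx.
- move=> s /andP[a_s sb] fs; exists d => // s' /andP[ss' s'd] s'b.
  rewrite (total_variationD _ a_s (ltW ss')) fin_numD fs.
  by apply: small; [exact: ltW|lra].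
- move=> s /andP[a_s sb] IH.
  pose u := Num.max a (s - d / 2).
  have u1 : a <= u by rewrite le_max lexx.
  have u2 : s - d / 2 <= u by rewrite le_max lexx orbT.
  have u3 : u < s by rewrite gt_max; lra.
  rewrite (total_variationD _ u1 (ltW u3)) fin_numD IH ?u1//.
  by apply: small; [exact: ltW|lra].
Qed.

(* Constant to the left of [a], where [TV a x f] would be [-oo]. *)
Definition variation_function f a : R -> R :=
  fun x => fine (TV a (Num.max a x) f).

Lemma variation_functionB f a x y : abs_cont f -> x <= y ->
  variation_function f a y - variation_function f a x =
  fine (TV (Num.max a x) (Num.max a y) f).
Proof.
move=> acf xy; rewrite /variation_function.
have ax : a <= Num.max a x by rewrite le_max lexx.
have mxy : Num.max a x <= Num.max a y by rewrite ge_max !le_max lexx xy orbT.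
rewrite (total_variationD _ ax mxy) fineD ?abs_cont_total_variation_lty//.
by rewrite addrAC subrr add0r.
Qed.

Lemma variation_function_nondecreasing f a : abs_cont f ->
  nondecreasing (variation_function f a).
Proof.
move=> acf x y xy; rewrite -subr_ge0 variation_functionB// fine_ge0//.
by rewrite total_variation_ge0// ge_max !le_max lexx xy orbT.
Qed.

Lemma variation_function_ge f a x y : abs_cont f -> a <= x -> x <= y ->
  `|f y - f x| <= variation_function f a y - variation_function f a x.
Proof.
move=> acf ax xy; rewrite variation_functionB// -lee_fin fineK.
  rewrite !max_r//; first exact: total_variation_ge.
  exact: le_trans xy.
by apply: abs_cont_total_variation_lty => //; rewrite ge_max !le_max lexx xy orbT.
Qed.

(** Increments of the variation function are variations, hence nearly sums of increments of [f] over
    a refined chain of the same total length. *)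
Lemma abs_cont_variation_function f a : abs_cont f ->
  abs_cont (variation_function f a).
Proof.
move=> acf e e0; have [d d0 Hd] := acf (e / 2) ltac:(lra).
exists d => // s chs lens.
pose g x : R * R := (Num.max a x.1, Num.max a x.2).
have mono x y : x <= y -> Num.max a x <= Num.max a y.
  by move=> xy; rewrite ge_max !le_max lexx xy orbT.
have chgs : chain (map g s).
  move: chs => /andP[s12 ps]; apply/andP; split.
    by rewrite all_map; apply: sub_all s12 => x; apply: mono.
  rewrite pairwise_map; apply: sub_pairwise ps => x y; exact: mono.
have lgs : total_length (map g s) < d.
  apply: le_lt_trans lens; rewrite /total_length big_map.
  rewrite !big_seq; apply: ler_sum => x xs /=.
  have : x.1 <= x.2 by move: chs => /andP[/allP + _]; apply.
  by move=> ?; rewrite /Num.max; case: ltP => ?; case: ltP => ?; lra.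
(* The refinement errors add up to at most [e / 2]; the successor covers the empty chain. *)
have eta0 : 0 < e / 2 / (size (map g s)).+1%:R by rewrite !divr_gt0// ltr0n.
have [|s' [chs' _ lens' le]] := variation_refinement eta0 chgs (f := f).
  move=> _ /mapP[x xs ->]; apply: abs_cont_total_variation_lty => //=.
  by apply: mono; move: chs => /andP[/allP + _]; apply.
have := Hd s' chs'; rewrite lens' => /(_ lgs) le2.
have -> : total_increment (variation_function f a) s =
    \sum_(x <- map g s) fine (TV x.1 x.2 f).
  rewrite /total_increment big_map !big_seq; apply: eq_bigr => x xs.
  have x12 : x.1 <= x.2 by move: chs => /andP[/allP + _]; apply.
  rewrite ger0_norm; first by rewrite variation_functionB.
  by rewrite subr_ge0 variation_function_nondecreasing.
apply: (le_trans le); rewrite {2}[e]splitr lerD//.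
rewrite mulrAC ler_pdivrMr ?ltr0n// ler_pM2l; last lra.
by rewrite ler_nat.
Qed.

End AbsoluteContinuity.

(** * Stieltjes measures of absolutely continuous functions *)

Section Stieltjes.
Context (R : realType).
Implicit Types (a b c e d : R) (f v : R -> R).
Local Notation lambda := (@lebesgue_measure R).

Lemma abs_cont_continuous f : abs_cont f -> continuous f.
Proof.
move=> acf x; apply/cvgrPdist_le => e e0; have [d d0 Hd] := acf e e0.
exists d => //= y; rewrite /ball_ /= => xyd.
have H u w : u <= w -> w - u < d -> `|f w - f u| <= e.
  move=> uw uwd; have := Hd [:: (u, w)].
  rewrite /total_length /total_increment !big_seq1 /chain /= uw /=.
  by move=> /(_ erefl uwd).
have [xy|yx] := leP x y.
  by rewrite distrC; apply: H => //; move: xyd; rewrite distrC ger0_norm; lra.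
by apply: H; [exact: ltW|move: xyd; rewrite gtr0_norm; lra].
Qed.

Lemma stieltjes_measure v : nondecreasing v -> continuous v ->
  exists mu : {measure set (measurableTypeR R) -> \bar R},
    forall x y, x <= y -> mu `]x, y]%classic = (v y - v x)%:E.
Proof.
move=> ndv /right_continuousW rcv.
pose cv : cumulative R R := HB.pack v (isCumulative.Build R _ R v ndv rcv).
exists (lebesgue_stieltjes_measure cv) => x y xy.
rewrite /= /lebesgue_stieltjes_measure /measure_extension.
by rewrite measurable_mu_extE/=; [rewrite wlength_itv_bnd|exact: is_ocitv].
Qed.

(* [U] is exhausted from inside by unions of dyadic cells. *)
Lemma stieltjes_measure_open_small
    (mu : {measure set (measurableTypeR R) -> \bar R}) v :
  (forall x y, x <= y -> mu `]x, y]%classic = (v y - v x)%:E) ->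
  nondecreasing v -> abs_cont v ->
  forall e, 0 < e -> exists2 d, 0 < d & forall U : set R, open U ->
    (lambda U < d%:E)%E -> forall a b, (mu (U `&` `]a, b]) <= e%:E)%E.
Proof.
move=> muv ndv acv e e0; have [d d0 Hd] := acv e e0.
exists d => // U oU Ud a b.
have [ba|ab] := leP b a.
  by rewrite set_itv_ge ?bnd_simp -?leNgt// setI0 measure0 lee_fin ltW.
pose t n k : R := a + (b - a) * (k%:R / 2 ^+ n).
have p2 n : 0 < 2 ^+ n :> R by rewrite exprn_gt0.
have tS n k : t n.+1 (2 * k)%N = t n k.
  by rewrite /t natrM exprS -mulf_div divff// mul1r.
have tmono n k l : (k <= l)%N -> t n k <= t n l.
  move=> kl; rewrite lerD2l ler_pM2l ?subr_gt0// ler_pM2r ?invr_gt0//.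
  by rewrite ler_nat.
pose J n k : set R := `]t n k, t n k.+1]%classic.
have IS n k : J n k = J n.+1 (2 * k)%N `|` J n.+1 (2 * k).+1.
  rewrite /J tS -[X in `]_, X]%classic]tS mulnS.
  have h1 := @tmono n.+1 (2 * k)%N (2 * k).+1 (leqnSn _).
  have h2 := @tmono n.+1 (2 * k).+1 (2 * k).+2 (leqnSn _).
  move: h1 h2; rewrite tS => h1 h2; apply/seteqP.
  by split=> x /=; rewrite !in_itv /=; [case: (leP x (t n.+1 (2 * k).+1))|]; lra.
have Icover n x : a < x <= b -> exists2 k, (k < 2 ^ n)%N & J n k x.
  move=> xab; elim: n => [|n [k kn]].
    exists 0%N => //; rewrite /J /= in_itv /= /t expr0 !divr1.
    by rewrite mulr0 addr0 mulr1 [a + (b - a)]addrC subrK.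
  rewrite IS expnS => -[?|?]; [exists (2 * k)%N|exists (2 * k).+1] => //.
    by rewrite ltn_pmul2l.
  by have := leq_mul (leqnn 2) kn; rewrite mulnS.
have triv n : trivIset setT (J n).
  apply/trivIsetP => i j _ _; apply: contraNeq => /eqP/eqP/set0P[x []].
  rewrite /J /= !in_itv /= => /andP[ix xi] /andP[jx xj].
  rewrite eqn_leq -!(ltnS i) -!(ltnS j); apply/andP; split; rewrite ltnNge.
    by apply/negP => /tmono - /(_ n); lra.
  by apply/negP => /tmono - /(_ n); lra.
have trivo n m : trivIset setT (fun k : 'I_m => J n k).
  apply/trivIsetP => i j _ _ ij.
  by move/trivIsetP : (triv n) => /(_ (i : nat) (j : nat) Logic.I Logic.I ij).
pose F n : set R := \bigcup_(k in [set k | (k < 2 ^ n)%N /\ J n k `<=` U]) J n k.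
have FE n : F n = \big[setU/set0]_(k < 2 ^ n | `[< J n k `<=` U >]) J n k.
  rewrite -(big_mkord (fun k => `[< J n k `<=` U >]) (J n)) -bigcup_seq_cond.
  apply: eq_bigcupl; split=> k /=; rewrite mem_index_iota leq0n /=.
    by move=> [-> ?]; exact/asboolP.
  by move=> /andP[-> /asboolP].
have mI n k : measurable (J n k : set (measurableTypeR R)) by exact: measurable_itv.
have mF n : measurable (F n : set (measurableTypeR R)).
  by rewrite FE; apply: bigsetU_measurable.
(* The cells in [F n] form a chain whose total length is the Lebesgue measure of [F n], hence below
   [d], and whose [v]-increments add up to [mu (F n)]. The bound is uniform in [n] and passes to the
   union. *)
have muF n : (mu (F n) <= e%:E)%E.
  pose s := [seq (t n k, t n k.+1) | k <- index_iota 0 (2 ^ n) & `[< J n k `<=` U >]].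
  have chs : chain s.
    apply/andP; split.
      by rewrite all_map; apply/allP => k _ /=; exact: tmono.
    rewrite pairwise_map; apply: (@sub_pairwise _ ltn) => [k l /= kl|].
      exact: tmono.
    rewrite -sorted_pairwise; last exact: ltn_trans.
    apply: sorted_filter; first exact: ltn_trans.
    exact: iota_ltn_sorted.
  have lens : (total_length s)%:E = lambda (F n).
    rewrite FE measure_bigsetU_ord//.
    rewrite /total_length big_map big_filter big_mkord -sumEFin.
    apply: eq_bigr => k _; rewrite /J /=.
    rewrite (lebesgue_measure_itv `]t n k, t n k.+1])/= lte_fin.
    by have := @tmono n k k.+1 (leqnSn _); case: ltgtP => // <- _; rewrite subrr.
  have <- : (total_increment v s)%:E = mu (F n).
    rewrite FE measure_bigsetU_ord//.
    rewrite /total_increment big_map big_filter big_mkord -sumEFin.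
    apply: eq_bigr => k _; transitivity (v (t n k.+1) - v (t n k))%:E.
      by congr (_%:E); rewrite ger0_norm// subr_ge0; apply: ndv; exact: tmono.
    by rewrite -muv ?tmono.
  rewrite lee_fin; apply: Hd => //; rewrite -lte_fin lens.
  apply: le_lt_trans Ud; apply: le_measure; rewrite ?inE//.
    exact: open_measurable.
  by move=> x [k [_]]; apply.
have FU : U `&` `]a, b] = \bigcup_n F n.
  apply/seteqP; split=> [x [Ux]|x [n _ [k [kn IU] Ix]]]; last first.
    split; first exact: IU.
    move: Ix; rewrite /J /= !in_itv /= => /andP[kx xk].
    have : t n 0%N <= t n k by exact: tmono.
    have : t n k.+1 <= t n (2 ^ n)%N by exact: tmono.
    have -> : t n (2 ^ n)%N = b by rewrite /t natrX divff ?gt_eqF// mulr1; lra.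
    have -> : t n 0%N = a by rewrite /t mul0r mulr0 addr0.
    by move=> ? ?; apply/andP; split; lra.
  rewrite /= in_itv /= => xab.
  have /nbhs_ballP[r /= r0 rU] : nbhs x U by exact: open_nbhs_nbhs.
  have [n nr] : exists n : nat, (b - a) / 2 ^+ n < r.
    exists (Num.bound ((b - a) / r)).
    rewrite ltr_pdivrMr// mulrC -ltr_pdivrMr//.
    apply: (lt_le_trans (archi_boundP _)); first by rewrite divr_ge0 ?ltW// subr_gt0.
    by rewrite -natrX ler_nat ltnW// ltn_expl.
  have [k kn Ikx] := Icover n x xab.
  exists n => //; exists k => //; split => // y Iky; apply: rU.
  rewrite /ball /=; move: Ikx Iky; rewrite /J /= !in_itv /=.
  have : t n k.+1 = t n k + (b - a) / 2 ^+ n.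
    by rewrite /t -[k.+1%:R]natr1 [X in _ * X]mulrDl mulrDr addrA mul1r.
  by move=> -> xk yk; rewrite ltr_norml; lra.
have ndF : nondecreasing_seq F.
  apply/nondecreasing_seqP => n; apply/subsetPset => x [k [kn IU]].
  rewrite IS in IU *; move=> -[Ix|Ix].
    exists (2 * k)%N => //; split; first by rewrite expnS ltn_pmul2l.
    by move=> y Iy; apply: IU; left.
  exists (2 * k).+1 => //; split.
    by rewrite expnS; have := leq_mul (leqnn 2) kn; rewrite mulnS.
  by move=> y Iy; apply: IU; right.
rewrite FU.
have cv := nondecreasing_cvg_mu mF (bigcup_measurable (fun n _ => mF n)) ndF (mu := mu).
rewrite -(cvg_lim _ cv)//; apply: lime_le; first by apply/cvg_ex; eexists; exact: cv.
exact: nearW.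
Qed.

End Stieltjes.

(** * Differentiability and Dini inequalities almost everywhere *)

Section AlmostEverywhere.
Context (R : realType).
Implicit Types (a b e d : R) (f v V : R -> R).
Local Notation lambda := (@lebesgue_measure R).

Lemma null_set_open_cover (A : set R) d : lambda.-negligible A -> 0 < d ->
  exists U : set R, [/\ open U, A `<=` U & (lambda U < d%:E)%E].
Proof.
move=> [N [mN N0 AN]] d0.
have [|U [oU NU UN]] := lebesgue_regularity_outer mN _ d0.
  by rewrite /= [X in (X < _)%E]N0 ltry.
exists U; split => //; first exact: subset_trans NU.
have mU : measurable (U : set (measurableTypeR R)) by exact: open_measurable.
rewrite -(setDUK NU); apply: le_lt_trans UN.
rewrite measureU//; last 2 first.
- exact: measurableD.
- by rewrite setDIK.
by rewrite [X in (X + _)%E]N0 add0e.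
Qed.

(* The Stieltjes measure of [v] has a density with respect to Lebesgue measure;
   at its Lebesgue points [v] is differentiable. *)
Lemma derivable_ae_of_nondecreasing_abs_cont v a b :
  nondecreasing v -> abs_cont v ->
  {ae lambda, forall x, a < x < b -> derivable v x 1}.
Proof.
move=> ndv acv.
have [mu muv] := stieltjes_measure ndv (abs_cont_continuous acv).
have [ba|ab] := leP b a; first by apply: aeW => x /andP[? ?]; lra.
have mD : measurable (`]a, b]%classic : set (measurableTypeR R)).
  exact: measurable_itv.
have muD : (mu `]a, b]%classic < +oo)%E by rewrite muv ?ltry// ltW.
pose nu : {finite_measure set (measurableTypeR R) -> \bar R} := mfrestr mD muD.
have nuE A : nu A = mu (A `&` `]a, b]) by [].
(* Absolute continuity of [v] becomes domination of measures: a null set lies in open sets of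
   arbitrarily small length, which have small [mu]. *)
have nudom : nu `<< lambda.
  apply/null_content_dominatesP => A mA A0; rewrite nuE.
  apply/eqP; rewrite eq_le measure_ge0 andbT; apply/lee_addgt0Pr => e e0.
  rewrite add0e.
  have [d d0 Hd] := stieltjes_measure_open_small muv ndv acv e0.
  have [|U [oU AU Ud]] := @null_set_open_cover A d _ d0.
    by exists A; split.
  apply: le_trans (Hd _ oU Ud a b); apply: le_measure; rewrite ?inE.
  - exact: measurableI.
  - by apply: measurableI => //; exact: open_measurable.
  - exact: setSI.
have [g [g0 gfin gint gE]] := radon_nikodym_sigma_finite nudom.
pose h x := fine (g x).
have hg : EFin \o h = g by apply/funext => x /=; rewrite fineK.
have inth D : measurable D -> lambda.-integrable D (EFin \o h).
  by move=> mDD; rewrite hg; apply: integrableS gint.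
(* The indefinite integral of the density is differentiable almost everywhere, and on []a, b[] it
   equals [v - v a]. *)
have := @FTC1 R h (BRight a) _ (open_integrable_locally openT (inth setT measurableT)).
move=> /(_ (fun y => inth _ (measurable_itv _))) /=.
apply: filterS; first exact: (ae_filter_ringOfSetsType lambda).
move=> x dx /andP[ax xb].
have [] := dx; first by rewrite lte_fin.
move=> /(derivableD (derivable_cst (v a) _ _)) + _.
apply: near_eq_derivable.
near=> y.
have /andP[ay yb] : a < y < b by near: y; apply: near_in_itvoo; rewrite in_itv /= ax.
apply: (@EFin_inj R); rewrite /= EFinD /Rintegral fineK; last first.
  exact: integrable_fin_num (inth _ (measurable_itv _)).
have -> : (\int[lambda]_(x in `]a, y]) (h x)%:E = nu `]a, y]%classic)%E.
  rewrite gE; last exact: measurable_itv.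
  by apply: eq_integral => z _; rewrite -[LHS]/((EFin \o h) z) hg.
rewrite nuE setIidl; last first.
  by move=> z /=; rewrite !in_itv /=; lra.
by rewrite muv ?(ltW ay)// -EFinD; congr (_%:E); rewrite /cst /=; lra.
Unshelve. all: by end_near. Qed.

(* The null exceptional set has an open neighbourhood [U] of small Stieltjes
   measure; adding to [V s] the measure of the part of [U] to the left of [s]
   makes the Dini inequality hold everywhere. *)
Lemma dini_le_ae f V v a b : a <= b -> nondecreasing v -> abs_cont v ->
  (forall x y, a <= x -> x <= y -> y <= b -> V x <= V y) ->
  (forall x y, a <= x -> x <= y -> y <= b -> f y - f x <= v y - v x) ->
  {ae lambda, forall s, a < s < b -> forall e, 0 < e -> exists2 d, 0 < d &
     forall s', s < s' < s + d -> s' <= b ->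
       f s' - f s <= V s' - V s + e * (s' - s)} ->
  f b - f a <= V b - V a.
Proof.
move=> ab ndv acv Vmono fv [N [mN N0 NH]].
have [mu muv] := stieltjes_measure ndv (abs_cont_continuous acv).
apply/ler_addgt0Pr => e e0.
have [d d0 Hd] := stieltjes_measure_open_small muv ndv acv e0.
(* The point [a] joins the exceptional set because [dini_le] also asks for the inequality at [a],
   while the hypothesis speaks of the open interval. *)
have Na0 : lambda.-negligible (N `|` [set a]).
  apply: negligibleU; first by exists N; split.
  by exists [set a]; split => //; exact: lebesgue_measure_set1.
have [U [oU NU Ud]] := null_set_open_cover Na0 d0.
have mU : measurable (U : set (measurableTypeR R)) by exact: open_measurable.
have mUI x y : measurable (U `&` `]x, y] : set (measurableTypeR R)).
  by apply: measurableI => //; exact: measurable_itv.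
pose T s := fine (mu (U `&` `]a, s])).
have finI x y : mu (U `&` `]x, y]) \is a fin_num.
  rewrite ge0_fin_numE ?measure_ge0//; apply: le_lt_trans (ltry e).
  exact: Hd.
have TD s s' : a <= s -> s <= s' -> T s' - T s = fine (mu (U `&` `]s, s'])).
  move=> a_s ss'; rewrite /T.
  have -> : U `&` `]a, s'] = (U `&` `]a, s]) `|` (U `&` `]s, s']).
    rewrite -setIUr; congr (_ `&` _); apply/seteqP.
    by split=> x /=; rewrite !in_itv /=; [case: (leP x s)|]; lra.
  rewrite measureU//; last first.
    apply/seteqP; split => // x /= [[_ +] [_]]; rewrite !in_itv /=; lra.
  by rewrite (fineD (finI _ _) (finI _ _)) addrAC subrr add0r.
have Tmono s s' : a <= s -> s <= s' -> T s <= T s'.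
  by move=> ? ?; rewrite -subr_ge0 TD// fine_ge0.
have Ta : 0 <= T a by exact: fine_ge0.
have Tb : T b <= e by rewrite -lee_fin fineK//; exact: Hd.
suff : f b - f a <= (V \+ T) b - (V \+ T) a by rewrite /=; lra.
apply: dini_le => //.
- move=> s /andP[a_s sb] eta eta0.
  have cv : continuous v by exact: abs_cont_continuous.
  have /cvgrPdist_le/(_ _ eta0)[r /= r0 Hr] := cv s.
  exists r => // s' /andP[rs' s's] as'.
  have /Hr : ball_ Num.norm s r s' by rewrite /ball_ /= gtr0_norm; lra.
  rewrite ler_norml => /andP[_ vs].
  by have := fv s' s as' (ltW s's) sb; lra.
- move=> x y ax xy yb; apply: lerD; first exact: Vmono.
  exact: Tmono.
- move=> s /andP[a_s sb] eta eta0.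
  (* Just to the right of an exceptional point the increments of [T] are those of [v], which
     dominate those of [f]; elsewhere [T] is merely nondecreasing and the hypothesis applies. *)
  have [sN|sN] := pselect ((N `|` [set a]) s).
    have /nbhs_ballP[r /= r0 rU] : nbhs s U.
      by apply: open_nbhs_nbhs; split => //; exact: NU.
    exists r => // s' /andP[ss' s'r] s'b.
    have := TD s s' a_s (ltW ss'); rewrite setIidr; last first.
      move=> x /=; rewrite in_itv /= => xs; apply: rU.
      by rewrite /ball /= ltr_norml; lra.
    rewrite muv ?(ltW ss')//= => TE.
    have := Vmono s s' a_s (ltW ss') s'b; have := fv s s' a_s (ltW ss') s'b.
    have : 0 <= eta * (s' - s) by rewrite mulr_ge0; lra.
    by rewrite /=; lra.
  have {}a_s : a < s.
    by rewrite lt_neqAle a_s andbT; apply/eqP => sa; apply: sN; right.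
  have [|r r0 Hr] := @contrapT (exists2 d, 0 < d & forall s', s < s' < s + d ->
      s' <= b -> f s' - f s <= V s' - V s + eta * (s' - s)).
    move=> H; apply: sN; left; apply: NH => /= Hs; apply: H; apply: Hs => //.
    by rewrite a_s.
  exists r => // s' ss' s'b; have := Hr s' ss' s'b.
  by have := Tmono s s' ltac:(lra) ltac:(lra); rewrite /=; lra.
Qed.

End AlmostEverywhere.

(** * From disjoint families of intervals to chains *)

Section Families.
Context (R : realType).
Implicit Types (a b c e d : R) (f : R -> R) (s : seq (R * R)).

Definition clip a b x : R := Num.max a (Num.min b x).

Lemma clip_itv a b x : a <= b -> a <= clip a b x <= b.
Proof.
by move=> ab; rewrite /clip le_max lexx /= ge_max ab ge_min lexx.
Qed.

Lemma clip_id a b x : a <= x <= b -> clip a b x = x.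
Proof. by move=> /andP[ax xb]; rewrite /clip min_r// max_r. Qed.

Lemma le_clip a b x y : x <= y -> clip a b x <= clip a b y.
Proof.
move=> xy; rewrite /clip ge_max le_max lexx /= le_max; apply/orP; right.
by rewrite le_min !ge_min lexx xy orbT.
Qed.

Lemma clipB_le a b x y : a <= b -> x <= y -> clip a b y - clip a b x <= y - x.
Proof.
move=> ab xy; rewrite /clip /Num.max /Num.min.
by case: (ltP b x) => ?; case: (ltP b y) => ?; case: ltP => ?; case: ltP => ?; lra.
Qed.

(** Bridge from the definition of absolutely continuous paths, with unordered families of
    nondegenerate disjoint intervals inside [[a, b]], to chains on the line. *)
Lemma abs_cont_clip f a b : a <= b ->
  (forall e, 0 < e -> exists2 d, 0 < d & forall m (l r : 'I_m -> R),
     (forall k, [/\ a <= l k, l k < r k & r k <= b]) ->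
     trivIset [set: 'I_m] (fun k => `]l k, r k[%classic) ->
     \sum_(k < m) (r k - l k) < d -> \sum_(k < m) `|f (r k) - f (l k)| <= e) ->
  abs_cont (f \o clip a b).
Proof.
move=> ab H e e0; have [d d0 Hd] := H e e0; exists d => // s /andP[s12 ps] lens.
pose g (x : R * R) : R * R := (clip a b x.1, clip a b x.2).
(* Clipping can make an interval degenerate. Such intervals are dropped; they contribute 0 both to
   the length and to the increment. *)
pose z := [seq y <- map g s | y.1 < y.2].
have zs x : x \in z -> [/\ a <= x.1, x.1 < x.2 & x.2 <= b].
  rewrite mem_filter => /andP[x12 /mapP[y ys xE]]; split=> //.
    by rewrite xE; case/andP: (clip_itv y.1 ab).
  by rewrite xE; case/andP: (clip_itv y.2 ab).
have pz : pairwise (fun x y : R * R => x.2 <= y.1) z.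
  apply: (subseq_pairwise (filter_subseq _ _)); rewrite pairwise_map.
  by apply: sub_pairwise ps => x y; exact: le_clip.
have sum_z (F : R * R -> R) : (forall x, x.1 = x.2 -> F x = 0) ->
    \sum_(k < size z) F (nth (a, a) z k) = \sum_(x <- s) F (g x).
  move=> F0; transitivity (\sum_(x <- z) F x).
    by rewrite (big_nth (a, a)) big_mkord.
  rewrite big_filter big_map [RHS](bigID (fun x => (g x).1 < (g x).2))/=.
  rewrite [X in _ = _ + X]big1_seq ?addr0// => x /andP[xg xs]; apply: F0.
  apply/eqP; rewrite eq_le [X in _ && X]leNgt xg andbT.
  by apply: le_clip; move/allP: s12; apply.
have := Hd (size z) (fun k => (nth (a, a) z k).1) (fun k => (nth (a, a) z k).2).
rewrite (sum_z (fun x => x.2 - x.1)); last by move=> x ->; rewrite subrr.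
rewrite (sum_z (fun x => `|f x.2 - f x.1|)); last by move=> x ->; rewrite subrr normr0.
apply.
- by move=> k; apply: zs; exact: mem_nth.
- apply/trivIsetP => i j _ _ ij.
  wlog {ij} ij : i j / (i < j)%N.
    move=> W; have [||/val_inj ij'] := ltngtP i j; first exact: W.
      by rewrite setIC; exact: W.
    by rewrite ij' eqxx in ij.
  have /(pairwiseP (a, a))/(_ i j) := pz.
  rewrite !inE !ltn_ord => /(_ isT isT ij) zij.
  by apply/seteqP; split => // x []; rewrite /= !in_itv /=; lra.
- apply: le_lt_trans lens; rewrite /total_length !big_seq; apply: ler_sum.
  by move=> x xs /=; apply: clipB_le => //; move/allP: s12; apply.
Qed.

End Families.

(** * Operations on absolutely continuous functions, and their derivatives *)

Section AbsoluteContinuityClosure.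
Context (R : realType).
Implicit Types (f g : R -> R) (a b c : R).

Lemma abs_cont_comp f g : nondecreasing g ->
  (forall x y, x <= y -> g y - g x <= y - x) -> abs_cont f -> abs_cont (f \o g).
Proof.
move=> ndg lipg acf e e0; have [d d0 Hd] := acf e e0; exists d => // s chs lens.
pose h (x : R * R) : R * R := (g x.1, g x.2).
have -> : total_increment (f \o g) s = total_increment f (map h s).
  by rewrite /total_increment big_map.
have /andP[s12 ps] := chs; apply: Hd.
  apply/andP; split.
    by rewrite all_map; apply: sub_all s12 => x; exact: ndg.
  by rewrite pairwise_map; apply: sub_pairwise ps => x y; exact: ndg.
apply: le_lt_trans lens; rewrite /total_length big_map !big_seq.
by apply: ler_sum => x xs; apply: lipg; move/allP: s12; apply.
Qed.

Lemma abs_contD f g : abs_cont f -> abs_cont g -> abs_cont (fun x => f x + g x).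
Proof.
move=> acf acg e e0.
have e20 : 0 < e / 2 by lra.
have [d1 d10 H1] := acf _ e20; have [d2 d20 H2] := acg _ e20.
exists (Num.min d1 d2) => [|s chs]; first by rewrite lt_min d10.
rewrite lt_min => /andP[s1 s2].
have := lerD (H1 s chs s1) (H2 s chs s2); rewrite -splitr; apply: le_trans.
rewrite /total_increment -big_split; apply: ler_sum => x _ /=.
by rewrite opprD addrACA ler_normD.
Qed.

Lemma abs_contZ c f : abs_cont f -> abs_cont (fun x => c * f x).
Proof.
move=> acf e e0; have c0 : 0 < `|c| + 1 by rewrite ltr_wpDl.
have [d d0 H] := acf (e / (`|c| + 1)) ltac:(exact: divr_gt0).
exists d => // s chs lens; have := H s chs lens.
rewrite ler_pdivlMr// mulrC; apply: le_trans.
rewrite /total_increment mulr_sumr; apply: ler_sum => x _.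
by rewrite -mulrBr normrM ler_wpM2r// lerDl.
Qed.

Lemma abs_cont_sum (I : Type) (r : seq I) (f : I -> R -> R) :
  (forall i, abs_cont (f i)) -> abs_cont (fun x => \sum_(i <- r) f i x).
Proof.
move=> acf; elim: r => [|i r IH].
  move=> e e0; exists 1 => // s _ _; rewrite /total_increment big1 ?ltW// => x _.
  by rewrite !big_nil subrr normr0.
have -> : (fun x => \sum_(j <- i :: r) f j x) =
    (fun x => f i x + \sum_(j <- r) f j x).
  by apply/funext => x; rewrite big_cons.
exact: abs_contD.
Qed.

(** Jordan decomposition: [f] is the difference of the nondecreasing functions [v + f] and [v].
    Extending [f] by a constant to the left of [a] makes this true on the whole line without
    changing derivatives in []a, b[]. *)
Lemma derivable_ae_of_abs_cont f a b : abs_cont f ->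
  {ae @lebesgue_measure R, forall x, a < x < b -> derivable f x 1}.
Proof.
move=> acf; pose g x := f (Num.max a x); pose v := variation_function f a.
have ndmax : nondecreasing (Num.max a : R -> R).
  by move=> x y xy; rewrite ge_max !le_max lexx xy orbT.
have acg : abs_cont g.
  apply: (abs_cont_comp (f := f)) => // x y xy.
  by rewrite /Num.max; case: ltP => ?; case: ltP => ?; lra.
have vmax x : v x = v (Num.max a x).
  by rewrite /v /variation_function maxA maxxx.
have acv : abs_cont v by exact: abs_cont_variation_function.
have ndu : nondecreasing (fun x => v x + g x).
  move=> x y xy; rewrite (vmax x) (vmax y) /g.
  have := @variation_function_ge _ f a (Num.max a x) (Num.max a y) acf _ (ndmax _ _ xy).
  rewrite le_max lexx ler_norml => /(_ isT); rewrite -/v; lra.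
have ndv : nondecreasing v by exact: variation_function_nondecreasing.
have := derivable_ae_of_nondecreasing_abs_cont a b ndv acv.
have := derivable_ae_of_nondecreasing_abs_cont a b ndu (abs_contD acv acg).
have aeF := ae_filter_ringOfSetsType (@lebesgue_measure R).
apply: filterS2 => x Hu Hv xab; have := derivableB (Hu xab) (Hv xab).
apply: near_eq_derivable.
have xr : x \in `]a, b[ by rewrite in_itv.
near=> y; rewrite /= addrAC subrr add0r /g max_r// ltW//.
have /andP[//] : a < y < b by near: y; exact: near_in_itvoo.
Unshelve. all: by end_near. Qed.

End AbsoluteContinuityClosure.

(** * Charts and Lagrangians *)

Lemma diff_comp_eq (R : numFieldType) (U V W : normedModType R)
    (f : U -> V) (g : V -> W) x y v :
  differentiable f x -> differentiable g y -> f x = y ->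
  differentiable (g \o f) x /\ 'd (g \o f) x v = 'd g y ('d f x v).
Proof.
move=> df dg fx; subst y; split; first exact: differentiable_comp.
by rewrite diff_comp.
Qed.

Section Charts.
Context (R : realType) (n : nat) (M : smoothManifold R n).
Implicit Types (p q : M) (i j k : chart_index M) (w : 'rV[R]_n) (s : R).

Lemma nbhs_dom i p : dom i p -> nbhs p (dom i).
Proof. by move=> ip; apply: open_nbhs_nbhs; split => //; exact: dom_open. Qed.

Lemma chart_cvg i p : dom i p -> chart i q @[q --> p] --> chart i p.
Proof. by move=> ip; apply: chart_continuous; rewrite inE. Qed.

Lemma chartVK i p : dom i p -> chartV i (chart i p) = p.
Proof. by move=> ip; apply: (@chartK _ _ M i); rewrite inE. Qed.

Lemma chartV_cvg i p : dom i p -> chartV i u @[u --> chart i p] --> p.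
Proof.
move=> ip; rewrite -{2}(chartVK ip); apply: chartV_continuous.
by rewrite inE; exists p.
Qed.

Lemma near_chartV i p (A : set M) : dom i p -> nbhs p A ->
  \forall u \near chart i p, A (chartV i u).
Proof. by move=> ip; move: (chartV_cvg ip) => /(_ A). Qed.

Lemma near_chart_image i p : dom i p ->
  \forall u \near chart i p, dom i (chartV i u) /\ chart i (chartV i u) = u.
Proof.
move=> ip; have : nbhs (chart i p) (chart i @` dom i).
  by apply: open_nbhs_nbhs; split; [exact: chart_image_open|exists p].
by apply: filterS => _ [q iq <-]; rewrite chartVK.
Qed.

Lemma transition_differentiable i j p : dom i p -> dom j p ->
  differentiable (chart j \o chartV i) (chart i p).
Proof.
move=> ip jp; have [D _] := @transition_smooth _ _ M i j 1.
by apply: D; rewrite inE; exists p.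
Qed.

Lemma transition_comp i j k p : dom i p -> dom j p ->
  \forall u \near chart i p,
    (chart k \o chartV i) u = ((chart k \o chartV j) \o (chart j \o chartV i)) u.
Proof.
move=> ip jp; have := near_chart_image ip.
have : \forall u \near chart i p, dom j (chartV i u).
  by apply: (chartV_cvg ip); exact: nbhs_dom.
by apply: filterS2 => u jpu _ /=; rewrite chartVK.
Qed.

Lemma diff_transition_comp i j k p w : dom i p -> dom j p -> dom k p ->
  'd (chart k \o chartV j) (chart j p) ('d (chart j \o chartV i) (chart i p) w)
  = 'd (chart k \o chartV i) (chart i p) w.
Proof.
move=> ip jp kp.
have dij := transition_differentiable ip jp.
have djk := transition_differentiable jp kp.
have dik := transition_differentiable ip kp.
have e : (chart j \o chartV i) (chart i p) = chart j p.
  by rewrite /comp chartVK.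
have [dc dcE] := diff_comp_eq w dij djk e.
apply: etrans (esym dcE) _.
apply: etrans (esym (deriveE _ dc)) (etrans _ (deriveE _ dik)).
apply/esym/near_eq_derive.
exact: transition_comp.
Qed.

Lemma diff_transition_id i p w : dom i p ->
  'd (chart i \o chartV i) (chart i p) w = w.
Proof.
move=> ip; rewrite -deriveE; last exact: transition_differentiable.
rewrite (near_eq_derive (g := id)) ?derive_id//.
by apply: filterS (near_chart_image ip) => u [].
Qed.

Lemma tvecE i j p w : dom j p ->
  tvec i p w j = 'd (chart j \o chartV i) (chart i p) w.
Proof. by move=> jp; rewrite /tvec ifT// inE. Qed.

Lemma tvec_self i p w : dom i p -> tvec i p w i = w.
Proof. by move=> ip; rewrite tvecE// diff_transition_id. Qed.

Lemma tangent_tvec i p w : dom i p -> tangent p (tvec i p w).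
Proof.
move=> ip; split=> [j njp|j k jp kp]; first by rewrite /tvec memNset.
rewrite (tvecE i w jp) (tvecE i w kp); exact/esym/diff_transition_comp.
Qed.

Lemma tvecD i p w1 w2 : tvec i p (w1 + w2) = tvec i p w1 + tvec i p w2.
Proof.
apply/funext => j; rewrite /tvec /=.
by rewrite [RHS]/GRing.add /=; case: ifP => _; rewrite ?linearD ?addr0.
Qed.

Lemma tvecZ i p a w : tvec i p (a *: w) = a *: tvec i p w.
Proof.
apply/funext => j; rewrite [RHS]/GRing.scale /= /tvec.
by case: ifP => _; rewrite ?linearZ ?scaler0.
Qed.

Lemma tvec0 i p : tvec i p 0 = 0.
Proof. by rewrite -[0 in LHS](scale0r 0) tvecZ scale0r. Qed.

Lemma tvec_eq0 i p w : dom i p -> tvec i p w = 0 -> w = 0.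
Proof. by move=> ip w0; rewrite -(tvec_self w ip) w0. Qed.

(** Differentiability in one chart suffices: the chain rule through the transition maps gives the
    derivative in every other chart around the point. *)
Lemma velocity_tvec (gamma : R -> M) i s w : dom i (gamma s) ->
  (\near s, dom i (gamma s)) -> is_derive s 1 (chart i \o gamma) w ->
  velocity gamma s = tvec i (gamma s) w.
Proof.
move=> is_ nis [dgamma dw]; apply/funext => j; rewrite /velocity /tvec.
case: ifPn => //; rewrite inE => js.
have dg : differentiable (chart i \o gamma) s by exact/derivable1_diffP.
have dt := transition_differentiable is_ js.
have [dc dcE] := diff_comp_eq (1 : R) dg dt erefl.
rewrite -dw (deriveE _ dg); apply: etrans _ dcE.
apply: etrans _ (deriveE _ dc); rewrite derive1E.
apply: near_eq_derive; apply: filterS nis => u iu.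
by rewrite /comp chartVK.
Qed.

End Charts.

(** * Uniform estimates for continuous families of homogeneous functions *)

Section HomogeneousFamily.
Context (R : realType) (n : nat).
Implicit Types w : 'rV[R]_n.

Definition homogeneous (f : 'rV[R]_n -> R) :=
  forall a w, 0 <= a -> f (a *: w) = a * f w.

Lemma homogeneous0 f : homogeneous f -> f 0 = 0.
Proof. by move=> hf; rewrite -(scale0r 0) hf// mul0r. Qed.

Lemma homogeneous_le f g : homogeneous f -> homogeneous g ->
  (forall w, `|w| = 1 -> f w <= g w) -> forall w, f w <= g w.
Proof.
move=> hf hg H w; have [->|w0] := eqVneq w 0; first by rewrite !homogeneous0.
have w_gt0 : 0 < `|w| by rewrite normr_gt0.
have -> : w = `|w| *: (`|w|^-1 *: w).
  by rewrite scalerA divff ?scale1r// gt_eqF.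
rewrite hf// hg// ler_pM2l//; apply: H.
by rewrite normrZ normfV normr_id mulVf// gt_eqF.
Qed.

Lemma compact_unit_sphere : compact [set w : 'rV[R]_n | `|w| = 1].
Proof.
apply: bounded_closed_compact.
  exists 1; split; first exact: num_real.
  by move=> x x1 w /= ->; exact: ltW.
apply: (@preimage_closed _ _ (fun w : 'rV[R]_n => `|w|) [set x | x = 1]).
  by move=> w _; exact: norm_continuous.
exact: closed_eq.
Qed.

Context (X : topologicalType) (p : X) (N : X -> 'rV[R]_n -> R).
Hypothesis N_cvg : forall w, N q.1 q.2 @[q --> (p, w)] --> N p w.
Hypothesis N_homogeneous : \forall q \near p, homogeneous (N q).

Let N_homogeneous_p : homogeneous (N p).
Proof. exact: nbhs_singleton N_homogeneous. Qed.

Let homogeneousM (c : R) : homogeneous (fun w => c * `|w|).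
Proof. by move=> a w a0; rewrite normrZ ger0_norm// mulrCA. Qed.

Let homogeneousD f g : homogeneous f -> homogeneous g ->
  homogeneous (fun w => f w + g w).
Proof. by move=> hf hg a w a0; rewrite hf// hg// mulrDr. Qed.

Let near_pair w (P : X -> 'rV[R]_n -> Prop) :
  (\forall q \near (p, w), P q.1 q.2) ->
  \forall w' \near w & q \near p, P q w'.
Proof.
move=> [[A B] /= [pA wB] AB]; exists (B, A) => //= -[w' q] [/= Bw' Aq].
exact: (AB (q, w')).
Qed.

(** Joint continuity at the pairs [(p, w)] is uniform for [w] on the compact unit sphere, and
    homogeneity carries the bound to all [w]. *)
Lemma homogeneous_family_close e : 0 < e ->
  \forall q \near p, forall w, `|N q w - N p w| <= e * `|w|.
Proof.
move=> e0.
have HS : \forall q \near p, [set w : 'rV[R]_n | `|w| = 1] `<=`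
    (fun w => `|N q w - N p w| <= e).
  apply: (iffLR (compact_near_coveringP _) compact_unit_sphere).
  move=> w _; apply: (@near_pair w (fun q w' => `|N q w' - N p w'| <= e)).
  have /cvgrPdist_le/(_ (e / 2)) := @N_cvg w; move=> /(_ ltac:(lra)) Hw.
  (* [N q w'] is to be compared with [N p w'], not with [N p w]; the second half of [e] pays for
     moving [w] to [w'], by the same neighbourhood with [q = p]. *)
  have Hp : \forall q \near (p, w), `|N p w - N p q.2| <= e / 2.
    case: Hw => -[A B] /= [pA wB] AB; exists (A, B) => //= -[q w'] [_ /= Bw'].
    by apply: (AB (p, w')); split => //; exact: nbhs_singleton.
  apply: filterS2 Hw Hp => -[q w'] /= H1 H2.
  rewrite [e]splitr (_ : N q w' - N p w' = - (N p w - N q w') + (N p w - N p w')).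
    by rewrite (le_trans (ler_normD _ _))// normrN lerD.
  by rewrite opprB addrA subrK.
apply: filterS2 N_homogeneous HS => q hq Hq w.
have up : forall w, N q w <= N p w + e * `|w|.
  apply: homogeneous_le => //.
    exact: (homogeneousD N_homogeneous_p (homogeneousM e)).
  by move=> w1 w11; have := Hq w1 w11; rewrite w11 mulr1 ler_norml; lra.
have down : forall w, N p w <= N q w + e * `|w|.
  apply: homogeneous_le => //; first exact: (homogeneousD hq (homogeneousM e)).
  by move=> w1 w11; have := Hq w1 w11; rewrite w11 mulr1 ler_norml; lra.
by have := up w; have := down w; rewrite ler_norml; lra.
Qed.

Let cvg_p w : N p w' @[w' --> w] --> N p w.
Proof.
apply: (@cvg_comp _ _ _ (fun w' => (p, w')) (fun q => N q.1 q.2)).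
  apply: (@cvg_pair _ _ _ (nbhs w) (nbhs p) (nbhs w)) => //.
  exact: cvg_cst.
exact: N_cvg.
Qed.

(** [N p] has a positive lower bound on the sphere; half of it absorbs the variation with [q]. *)
Lemma homogeneous_family_lower : (forall w, w != 0 -> 0 < N p w) ->
  exists2 c, 0 < c & \forall q \near p, forall w, c * `|w| <= N q w.
Proof.
move=> N_gt0.
(* Compactness is used in its filter form, with the candidate constants [c] tending to 0 from the
   right as parameters, in place of a minimum on the sphere. *)
have HS : \forall c \near (0 : R)^'+, [set w : 'rV[R]_n | `|w| = 1] `<=`
    (fun w => c <= N p w).
  apply: (iffLR (compact_near_coveringP _) compact_unit_sphere) => w w1.
  have Nw : 0 < N p w by apply: N_gt0; rewrite -normr_eq0 w1 oner_neq0.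
  have Nw2 : 0 < N p w / 2 by lra.
  exists ([set w' | N p w / 2 <= N p w'], [set c | 0 < c < N p w / 2]) => /=.
    split; last first.
      by near=> c; apply/andP; split; near: c;
        [exact: nbhs_right_gt|exact: nbhs_right_lt].
    have /cvgrPdist_le/(_ _ Nw2) := @cvg_p w.
    by apply: filterS => w' /=; rewrite ler_norml; lra.
  by move=> [w' c] [] /= h /andP[_ /ltW cN]; exact: le_trans cN h.
have [c [c0 Hc]] : exists c, 0 < c /\ (forall w, `|w| = 1 -> c <= N p w).
  have : \forall c \near (0 : R)^'+, 0 < c /\ (forall w, `|w| = 1 -> c <= N p w).
    by apply: filterS2 (nbhs_right_gt 0) HS.
  by move=> /filter_ex.
exists (c / 2); first lra.
have c20 : 0 < c / 2 by lra.
apply: filterS (homogeneous_family_close c20) => q Hq w.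
have Hp : c * `|w| <= N p w.
  by move: w; apply: homogeneous_le => // w w1; rewrite w1 mulr1 Hc.
by have := Hq w; rewrite ler_norml; lra.
Unshelve. all: by end_near. Qed.

Lemma homogeneous_family_upper :
  exists2 C, 0 < C & \forall q \near p, forall w, N q w <= C * `|w|.
Proof.
have HS : \forall C \near +oo, [set w : 'rV[R]_n | `|w| = 1] `<=`
    (fun w => N p w <= C).
  apply: (iffLR (compact_near_coveringP _) compact_unit_sphere) => w w1.
  exists ([set w' | N p w' <= N p w + 1], [set C | N p w + 1 <= C]) => /=.
    split; last exact: (nbhs_pinfty_ge (num_real _)).
    have /cvgrPdist_le/(_ _ ltr01) := @cvg_p w.
    by apply: filterS => w' /=; rewrite ler_norml; lra.
  by move=> [w' C] [] /=; exact: le_trans.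
have [C [C0 HC]] : exists C, 0 < C /\ (forall w, `|w| = 1 -> N p w <= C).
  have : \forall C \near +oo, 0 < C /\ (forall w, `|w| = 1 -> N p w <= C).
    by apply: filterS2 (nbhs_pinfty_gt (num_real 0)) HS.
  by move=> /filter_ex.
exists (C + 1); first lra.
apply: filterS (homogeneous_family_close ltr01) => q Hq w.
have Hp : N p w <= C * `|w|.
  by move: w; apply: homogeneous_le => // w w1; rewrite w1 mulr1 HC.
by have := Hq w; rewrite ler_norml; lra.
Qed.

End HomogeneousFamily.

(** * Finsler structures as Lagrangians, and their local bounds *)

Section Lagrangians.
Context (R : realType) (n : nat) (M : smoothManifold R n).
Local Notation vec := (chart_index M -> 'rV[R]_n).
Implicit Types (F : M -> vec -> R) (p q : M) (i : chart_index M).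
Implicit Types (w : 'rV[R]_n).

(** Common ground of Finsler structures and Riemannian norms. Without subadditivity among the
    fields, the norm of a Riemannian metric qualifies with no appeal to the Cauchy-Schwarz
    inequality. *)
Record lagrangian F : Prop := Lagrangian {
  lagrangian_cvg : forall i p w, dom i p ->
    F q.1 (tvec i q.1 q.2) @[q --> (p, w)] --> F p (tvec i p w);
  lagrangian_ge0 : forall p v, tangent p v -> 0 <= F p v;
  lagrangian_homogeneous : forall p a v, 0 <= a -> tangent p v ->
    F p (a *: v) = a * F p v;
  lagrangian_eq0 : forall p v, tangent p v -> F p v = 0 -> v = 0 }.

Lemma tangent0 p : tangent p 0.
Proof. by split=> // i j _ _; rewrite [0 i]/(0 : 'rV[R]_n) linear0. Qed.

Lemma finsler_lagrangian F : finsler_structure F -> lagrangian F.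
Proof.
move=> hF; split.
- move=> i p w ip; have H := finsler_continuous hF.
  by apply: (H i (p, w)); rewrite inE.
- exact: finsler_ge0.
- by move=> p a v a0 /(finsler_homogeneous hF); apply.
- by move=> p v vp /(finsler_eq0 hF vp).
Qed.

Lemma finsler_max F1 F2 (t : R) : 0 <= t <= 1 ->
  finsler_structure F1 -> finsler_structure F2 ->
  finsler_structure (max_lagrangian t F1 F2).
Proof.
move=> /andP[t0 t1] hF1 hF2; have t1' : 0 <= 1 - t by rewrite subr_ge0.
split.
- move=> i x xi.
  have H1 := finsler_continuous hF1; have H2 := finsler_continuous hF2.
  pose G F (z : M * 'rV[R]_n) : R^o := F z.1 (tvec i z.1 z.2).
  have c1 : {for x, continuous (fun z => (1 - t) * G F1 z : R^o)}.
    by apply: cvgM; [exact: cvg_cst|exact: (H1 i x xi)].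
  have c2 : {for x, continuous (fun z => t * G F2 z : R^o)}.
    by apply: cvgM; [exact: cvg_cst|exact: (H2 i x xi)].
  exact: (continuous_max c1 c2).
- move=> x v xv; rewrite /max_lagrangian le_max mulr_ge0//.
  exact: finsler_ge0 hF1 _ _ xv.
- move=> x v1 v2 xv1 xv2; rewrite /max_lagrangian ge_max.
  have /(ler_wpM2l t1') h1 := finsler_subadditive hF1 xv1 xv2.
  have /(ler_wpM2l t0) h2 := finsler_subadditive hF2 xv1 xv2.
  apply/andP; split.
    by rewrite (le_trans h1)// mulrDr lerD// le_max lexx.
  by rewrite (le_trans h2)// mulrDr lerD// le_max lexx orbT.
- move=> x lam v lam0 xv; rewrite /max_lagrangian.
  rewrite (finsler_homogeneous hF1)// (finsler_homogeneous hF2)//.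
  by rewrite maxr_pMr// !(mulrCA lam).
- move=> x v xv; rewrite /max_lagrangian; split=> [|v0]; last first.
    by rewrite ((finsler_eq0 hF1 xv).2 v0) ((finsler_eq0 hF2 xv).2 v0) !mulr0 maxxx.
  have h1 := finsler_ge0 hF1 xv; have h2 := finsler_ge0 hF2 xv.
  move=> max0.
  have : (1 - t) * F1 x v <= 0 by rewrite -max0 le_max lexx.
  have : t * F2 x v <= 0 by rewrite -max0 le_max lexx orbT.
  (* A nonzero coefficient forces [v = 0]: for [t = 0] it is that of [F1], otherwise that of
     [F2]. *)
  have [->|tn0] := eqVneq t 0.
    by rewrite subr0 mul1r => _ F10; apply/(finsler_eq0 hF1 xv)/eqP; rewrite eq_le F10.
  rewrite pmulr_rle0 ?lt_neqAle ?t0 ?andbT 1?eq_sym// => F20 _.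
  by apply/(finsler_eq0 hF2 xv)/eqP; rewrite eq_le F20.
Qed.

Section Local.
Context (F : M -> vec -> R) (hF : lagrangian F) (i : chart_index M) (p : M).
Hypothesis ip : dom i p.

Let N q w := F q (tvec i q w).

Let homN : \forall q \near p, homogeneous (N q).
Proof.
apply: filterS (nbhs_dom ip) => q iq a w a0.
by rewrite /N tvecZ (lagrangian_homogeneous hF a0)//; exact: tangent_tvec.
Qed.

Lemma lagrangian_close e : 0 < e -> \forall q \near p, forall w,
  `|F q (tvec i q w) - F p (tvec i p w)| <= e * `|w|.
Proof.
apply: (@homogeneous_family_close _ _ _ _ N _ homN) => w.
exact: lagrangian_cvg.
Qed.

Lemma lagrangian_lower : exists2 c, 0 < c &
  \forall q \near p, forall w, c * `|w| <= F q (tvec i q w).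
Proof.
apply: (@homogeneous_family_lower _ _ _ _ N _ homN) => w.
  exact: lagrangian_cvg.
move=> w0; rewrite lt_neqAle (lagrangian_ge0 hF (tangent_tvec w ip)) andbT.
apply/eqP => /esym/(lagrangian_eq0 hF (tangent_tvec w ip))/(tvec_eq0 ip) w0'.
by rewrite w0' eqxx in w0.
Qed.

Lemma lagrangian_upper : exists2 C, 0 < C &
  \forall q \near p, forall w, F q (tvec i q w) <= C * `|w|.
Proof.
apply: (@homogeneous_family_upper _ _ _ _ N _ homN) => w.
exact: lagrangian_cvg.
Qed.

End Local.

End Lagrangians.

(** * The norm of a Riemannian metric is a Lagrangian *)

Section Riemannian.
Context (R : realType) (n : nat) (M : smoothManifold R n).
Local Notation vec := (chart_index M -> 'rV[R]_n).
Implicit Types (p : M) (i : chart_index M) (w : 'rV[R]_n).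
Context (g : M -> vec -> vec -> R) (hg : riemannian_metric g).

Let metric0 p v : tangent p v -> g p 0 v = 0.
Proof.
move=> pv; have := riemannian_linear hg 1 (tangent0 p) (tangent0 p) pv.
by rewrite scale1r addr0 mul1r => /eqP; rewrite addrC -subr_eq subrr eq_sym => /eqP.
Qed.

Let metricZ p a v : tangent p v -> tangent p (a *: v) ->
  g p (a *: v) (a *: v) = a ^+ 2 * g p v v.
Proof.
move=> pv pav.
have Z u : tangent p u -> g p (a *: v) u = a * g p v u.
  move=> pu; have := riemannian_linear hg a pv (tangent0 p) pu.
  by rewrite !addr0 metric0// addr0.
by rewrite Z// (riemannian_sym hg pv pav) Z// mulrA.
Qed.

Let metric_sum p i v (I : Type) (s : seq I) (a : I -> R)
    (e : I -> 'rV[R]_n) : dom i p -> tangent p v ->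
  g p (tvec i p (\sum_(j <- s) a j *: e j)) v =
  \sum_(j <- s) a j * g p (tvec i p (e j)) v.
Proof.
move=> ip pv; elim: s => [|j s IH]; first by rewrite !big_nil tvec0 metric0.
rewrite !big_cons tvecD tvecZ riemannian_linear ?IH//; exact: tangent_tvec.
Qed.

(** Smoothness of the metric is stated for fixed coordinate vectors; the expansion in the standard
    basis turns it into joint continuity in the base point and the vector. *)
Let metric_coord p i w : dom i p ->
  g p (tvec i p w) (tvec i p w) =
  \sum_j \sum_k w 0 j * (w 0 k *
    g p (tvec i p (delta_mx 0 k)) (tvec i p (delta_mx 0 j))).
Proof.
move=> ip.
have expand v : tangent p v ->
    g p (tvec i p w) v = \sum_j w 0 j * g p (tvec i p (delta_mx 0 j)) v.
  by move=> pv; rewrite -metric_sum// -row_sum_delta.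
rewrite expand; last exact: tangent_tvec.
apply: eq_bigr => j _; rewrite (riemannian_sym hg); last 2 first.
- exact: tangent_tvec.
- exact: tangent_tvec.
by rewrite expand ?mulr_sumr//; exact: tangent_tvec.
Qed.

Let metric_coef_cvg p i w1 w2 : dom i p ->
  g q (tvec i q w1) (tvec i q w2) @[q --> p] -->
  g p (tvec i p w1) (tvec i p w2).
Proof.
move=> ip; pose h u := g (chartV i u) (tvec i (chartV i u) w1) (tvec i (chartV i u) w2).
have hc : h u @[u --> chart i p] --> h (chart i p).
  by apply: (riemannian_smooth hg i w1 w2 0); rewrite inE; exists p.
have : h (chart i q) @[q --> p] --> h (chart i p).
  exact: cvg_comp (chart_cvg ip) hc.
have hE q : dom i q -> h (chart i q) = g q (tvec i q w1) (tvec i q w2).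
  by move=> iq; rewrite /h (chartVK iq).
rewrite (hE p ip) => H; apply: cvg_trans H.
by apply: near_eq_cvg; apply: filterS (nbhs_dom ip) => q /hE.
Qed.

Lemma riemannian_lagrangian : lagrangian (fun p v => Num.sqrt (g p v v)).
Proof.
split=> [i p w ip|p v pv|p a v a0 pv|p v pv].
- have sc : {for g p (tvec i p w) (tvec i p w), continuous (@Num.sqrt R)}.
    exact: sqrt_continuous.
  suff H : g q.1 (tvec i q.1 q.2) (tvec i q.1 q.2) @[q --> (p, w)] -->
      g p (tvec i p w) (tvec i p w).
    exact: cvg_comp H sc.
  rewrite (metric_coord w ip).
  have nip : \forall q \near (p, w), dom i q.1.
    by apply: (@cvg_fst _ _ (nbhs p) (nbhs w)); exact: nbhs_dom.
  pose G j k (q : M) := g q (tvec i q (delta_mx 0 k)) (tvec i q (delta_mx 0 j)).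
  pose S (z : M * 'rV[R]_n) : R :=
    \sum_j \sum_k z.2 0 j * (z.2 0 k * G j k z.1).
  suff : S z @[z --> (p, w)] --> S (p, w).
    apply: cvg_trans; apply: near_eq_cvg; apply: filterS nip => q iq.
    by rewrite (metric_coord _ iq).
  have coord (j : 'I_n) :
      (fun z : M * 'rV[R]_n => z.2 0 j) @ nbhs (p, w) --> w 0 j.
    apply: (@cvg_comp _ _ _ snd (fun u : 'rV[R]_n => u 0 j)); first exact: cvg_snd.
    exact: coord_continuous.
  apply: cvg_big => [|j _]; first exact: add_continuous.
  apply: cvg_big => [|k _]; first exact: add_continuous.
  apply: cvgM; first exact: coord.
  apply: cvgM; first exact: coord.
  apply: (@cvg_comp _ _ _ fst (G j k)); first exact: cvg_fst.
  exact: metric_coef_cvg.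
- exact: sqrtr_ge0.
- have [a_0|an0] := eqVneq a 0.
    by rewrite a_0 scale0r metric0 ?sqrtr0 ?mul0r//; exact: tangent0.
  have pav : tangent p (a *: v).
    move: pv => [v1 v2]; split=> [j nj|j k jp kp].
      by rewrite [LHS](_ : _ = a *: v j)// v1// scaler0.
    rewrite [LHS](_ : _ = a *: v k)// [X in 'd _ _ X](_ : _ = a *: v j)//.
    by rewrite linearZ /= -v2.
  by rewrite metricZ// sqrtrM ?sqr_ge0// sqrtr_sqr ger0_norm.
- move=> /eqP; rewrite sqrtr_eq0 => gv; apply: contrapT => /(riemannian_posdef hg pv).
  by rewrite ltNge gv.
Qed.

End Riemannian.

(** * Lengths and distances *)

Lemma within_continuousP (R : realType) (T : topologicalType) (D : set R)
    (f : R -> T) : {within D, continuous f} <->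
  forall s, D s -> forall A, nbhs (f s) A -> exists2 d, 0 < d &
    forall u, D u -> `|s - u| < d -> A (f u).
Proof.
rewrite subspace_continuousP; split=> H s Ds A fA.
  have := H s Ds A fA; rewrite nbhs_nearE => /nbhs_ballP[d /= d0 Hd].
  by exists d => // u Du su; exact: Hd.
have [d d0 Hd] := H s Ds A fA; apply/nbhs_ballP; exists d => //= u su Du.
exact: Hd.
Qed.

(** * Coordinates of C^1 paths *)

Section PathsInCharts.
Context (R : realType) (n : nat) (M : smoothManifold R n).
Implicit Types (beta : R -> M) (i : chart_index M) (a b s u e : R).

(** At [a] and [b] only one-sided derivatives exist; the last clause is the form in which they are
    usable, a first order expansion relative to [[a, b]]. *)
Lemma C1_on_chart a b beta i : C1_on a b beta ->
  exists w : R -> 'rV[R]_n,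
  [/\ forall s, a < s < b -> dom i (beta s) ->
        is_derive s 1 (chart i \o beta) (w s),
      forall s e, a <= s <= b -> dom i (beta s) -> 0 < e ->
        exists2 d, 0 < d & forall u, a <= u <= b -> `|s - u| < d ->
          dom i (beta u) /\ `|w u - w s| <= e &
      forall s e, a <= s <= b -> dom i (beta s) -> 0 < e ->
        exists2 d, 0 < d & forall u, a <= u <= b -> `|s - u| < d ->
          `|chart i (beta u) - chart i (beta s) - (u - s) *: w s|
            <= e * `|u - s|].
Proof.
move=> [/within_continuousP cbeta /(_ i)[w [/within_continuousP cw quot]]].
have domd s : a <= s <= b -> dom i (beta s) -> exists2 d, 0 < d &
    forall u, a <= u <= b -> `|s - u| < d -> dom i (beta u).
  move=> sab is_; have [||d d0 Hd] := cbeta s _ (dom i); [|exact: nbhs_dom|].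
    by rewrite /= in_itv.
  by exists d => // u uab; apply: Hd; rewrite /= in_itv.
have quotd s e : a <= s <= b -> dom i (beta s) -> 0 < e ->
    exists2 d, 0 < d & forall u, a <= u <= b -> `|s - u| < d ->
      `|chart i (beta u) - chart i (beta s) - (u - s) *: w s| <= e * `|u - s|.
  move=> sab is_ e0.
  have /cvgrPdist_le/(_ e e0) := quot s sab is_.
  move=> /nbhs_ballP[d /= d0 Hd]; exists d => // u uab su.
  have [->|us] := eqVneq u s; first by rewrite !subrr scale0r subr0 !normr0 mulr0.
  have := Hd u su; rewrite /= in_itv /= => /(_ us uab) H.
  have -> : chart i (beta u) - chart i (beta s) - (u - s) *: w s =
      (u - s) *: ((u - s)^-1 *: (chart i (beta u) - chart i (beta s)) - w s).
    by rewrite scalerBr scalerA divff ?scale1r// subr_eq0.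
  by rewrite normrZ mulrC ler_wpM2r// distrC.
exists w; split => //.
- move=> s sab is_.
  have sab' : a <= s <= b by lra.
  have H : h^-1 *: ((chart i \o beta) (h *: 1 + s) - (chart i \o beta) s)
      @[h --> 0^'] --> w s.
    apply/cvgrPdist_le => e e0.
    have [d d0 Hd] := quotd s e sab' is_ e0.
    near=> h.
    have h0 : h != 0 by near: h; exact: nbhs_dnbhs_neq.
    have hd : `|h| < d by near: h; exact: dnbhs0_lt.
    have hab : a <= h + s <= b.
      have hm : `|h| < Num.min (s - a) (b - s).
        by near: h; apply: dnbhs0_lt; rewrite lt_min; lra.
      by move: hm; rewrite lt_min !ltr_norml; lra.
    have := Hd (h + s) hab; rewrite opprD addrCA subrr addr0 normrN => /(_ hd).
    rewrite addrK /= [h *: 1]mulr1 => Hh.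
    rewrite distrC -(ler_pM2l (_ : 0 < `|h|)) ?normr_gt0// [leRHS]mulrC -normrZ.
    by rewrite scalerBr scalerA divff// scale1r.
  split; [by apply/cvg_ex; exists (w s)|exact/cvg_lim].
- move=> s e sab is_ e0.
  have [d1 d10 H1] := domd s sab is_.
  have nb : nbhs (w s) [set v | `|w s - v| < e].
    by have /cvgrPdist_lt/(_ e e0) := @cvg_id _ (nbhs (w s)).
  have [|d2 d20 H2] := cw s _ _ nb; first by split=> //; rewrite /= in_itv.
  exists (Num.min d1 d2); first by rewrite lt_min d10.
  move=> u uab; rewrite lt_min => /andP[su1 su2]; have iu := H1 u uab su1.
  split=> //; rewrite distrC ltW//; apply: H2 => //.
Unshelve. all: by end_near. Qed.

End PathsInCharts.

Lemma partition_induction (R : realType) (P : R -> R -> Prop) (t : nat -> R) m :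
  (forall k, (k <= m)%N -> t k < t k.+1 /\ P (t k) (t k.+1)) ->
  (forall x y z, x < y -> y < z -> P x y -> P y z -> P x z) ->
  P (t 0%N) (t m.+1).
Proof.
move=> H trans; suff : t 0%N < t m.+1 /\ P (t 0%N) (t m.+1) by case.
elim: m H => [|m IH] H; first exact: H.
have [|lt0 P0] := IH; first by move=> k km; apply: H; exact: leqW.
have [lt1 P1] := H m.+1 (leqnn _).
by split; [exact: lt_trans lt1|exact: trans P0 P1].
Qed.

(** * Velocity and length of piecewise C^1 paths *)

Section Length.
Context (R : realType) (n : nat) (M : smoothManifold R n).
Local Notation vec := (chart_index M -> 'rV[R]_n).
Local Notation lambda := (@lebesgue_measure R).
Implicit Types (beta : R -> M) (i : chart_index M) (a b s u e : R).
Implicit Types (G : M -> vec -> R).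

Lemma chart_exists (p : M) : exists i, dom i p.
Proof.
have : [set: M] p by [].
by rewrite -(@dom_cover _ _ M) => -[i _ ip]; exists i.
Qed.

Lemma C1_on_near_dom a b beta i s : C1_on a b beta -> a < s < b ->
  dom i (beta s) -> \forall u \near s, dom i (beta u).
Proof.
move=> [/within_continuousP cbeta _] /andP[a_s sb] is_.
have [||d d0 Hd] := cbeta s _ (dom i); [|exact: nbhs_dom|].
  by rewrite /= in_itv /= !ltW.
have nab : \forall u \near s, a < u < b.
  by apply: near_in_itvoo; rewrite in_itv /= a_s.
apply: filterS2 nab (nbhsx_ballx s d d0) => u uab su.
by apply: Hd => //; rewrite /= in_itv /=; lra.
Qed.

Lemma C1_on_velocity a b beta i (w : R -> 'rV[R]_n) s :
  C1_on a b beta -> a < s < b -> dom i (beta s) ->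
  is_derive s 1 (chart i \o beta) (w s) ->
  velocity beta s = tvec i (beta s) (w s).
Proof.
move=> cb sab is_ dw; apply: velocity_tvec => //.
exact: C1_on_near_dom cb sab is_.
Qed.

Lemma integrand_continuous G a b beta s : lagrangian G -> C1_on a b beta ->
  a < s < b ->
  G (beta u) (velocity beta u) @[u --> s] --> G (beta s) (velocity beta s).
Proof.
move=> lG cb sab; have [i is_] := chart_exists (beta s).
have [w [dw cw _]] := C1_on_chart i cb.
have ni := C1_on_near_dom cb sab is_.
have nab : \forall u \near s, a < u < b.
  by apply: near_in_itvoo; rewrite in_itv.
have sab' : a <= s <= b by lra.
rewrite (C1_on_velocity cb sab is_ (dw s sab is_)).
have H : G (beta u) (tvec i (beta u) (w u)) @[u --> s] -->
    G (beta s) (tvec i (beta s) (w s)).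
  apply: (@cvg_comp _ _ _ (fun u => (beta u, w u))
    (fun z : M * 'rV[R]_n => G z.1 (tvec i z.1 z.2)) _ (nbhs (beta s, w s))).
    apply: (@cvg_pair _ _ _ (nbhs s) (nbhs (beta s)) (nbhs (w s))) => //.
      move=> A sA; have [/within_continuousP cbeta _] := cb.
      have [|d d0 Hd] := cbeta s _ A sA; first by rewrite /= in_itv.
      apply: filterS2 nab (nbhsx_ballx s d d0) => u uab su.
      by apply: Hd => //; rewrite /= in_itv /=; lra.
    apply/cvgrPdist_le => e e0; have [d d0 Hd] := cw s e sab' is_ e0.
    apply: filterS2 nab (nbhsx_ballx s d d0) => u uab su.
    by have [|_] := Hd u _ su; [lra|rewrite distrC].
  exact: lagrangian_cvg.
apply: cvg_trans H; apply: near_eq_cvg; apply: filterS2 nab ni => u uab iu.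
by rewrite (C1_on_velocity cb uab iu (dw u uab iu)).
Qed.

Lemma tangent_velocity a b beta s : C1_on a b beta -> a < s < b ->
  tangent (beta s) (velocity beta s).
Proof.
move=> cb sab; have [i is_] := chart_exists (beta s).
have [w [dw _ _]] := C1_on_chart i cb.
by rewrite (C1_on_velocity cb sab is_ (dw s sab is_)); exact: tangent_tvec.
Qed.

(** Inside each piece the integrand is continuous; the end points of the pieces, where [velocity]
    may be meaningless, are split off as single points. *)
Lemma piecewise_C1_measurable G a b beta : lagrangian G ->
  piecewise_C1 a b beta ->
  measurable_fun `[a, b]%classic (fun s => G (beta s) (velocity beta s)).
Proof.
move=> lG [m [t [<- <- Ht]]].
apply: (partition_induction (P := fun x y => measurable_fun `[x, y]%classic
    (fun s => G (beta s) (velocity beta s)))) => [k km|x y z xy yz mxy myz].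
  have [tk cb] := Ht k km; split => //.
  have -> : `[t k, t k.+1]%classic =
      [set t k] `|` (`]t k, t k.+1[ `|` [set t k.+1]).
    by rewrite setUitv1 ?bnd_simp// setU1itv// bnd_simp ltW.
  apply/measurable_funU => //; first exact: measurableU.
  split; first exact: measurable_fun_set1.
  apply/measurable_funU => //; split; last exact: measurable_fun_set1.
  apply: open_continuous_measurable_fun => // s.
  by rewrite inE /= in_itv => sab; exact: integrand_continuous cb sab.
have -> : `[x, z]%classic = `[x, y] `|` `[y, z].
  apply/seteqP; split=> u /=; rewrite !in_itv /=.
    by case: (leP u y) => ?; lra.
  by case; lra.
by apply/measurable_funU.
Qed.

Lemma piecewise_C1_lt a b beta : piecewise_C1 a b beta -> a < b.
Proof.
move=> [m [t [<- <- Ht]]].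
apply: (partition_induction (P := fun x y => x < y)) => [k /Ht[]//|x y z].
move=> xy yz _ _.
exact: lt_trans yz.
Qed.

Lemma piecewise_C1_tangent a b beta : piecewise_C1 a b beta ->
  {ae lambda, forall s, a <= s <= b -> tangent (beta s) (velocity beta s)}.
Proof.
move=> [m [t [<- <- Ht]]].
have aeF := ae_filter_ringOfSetsType lambda.
have ae_neq x : {ae lambda, forall s : R, s != x}.
  exists [set x]; split => //; first exact: lebesgue_measure_set1.
  by move=> s /= /negP; rewrite negbK => /eqP.
apply: (partition_induction (P := fun x y =>
    {ae lambda, forall s, x <= s <= y -> tangent (beta s) (velocity beta s)}))
    => [k km|x y z xy yz].
  have [tk cb] := Ht k km; split => //.
  apply: filterS2 (ae_neq (t k)) (ae_neq (t k.+1)) => s sk sk1 /andP[ks sk1'].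
  by apply: (tangent_velocity cb); rewrite !lt_neqAle eq_sym sk ks sk1 sk1'.
apply: filterS2 => s Hx Hy /andP[xs sz].
by have [sy|ys] := leP s y; [apply: Hx|apply: Hy]; lra.
Qed.

(* At the break points of a piecewise C^1 path [velocity] need not be tangent,
   and there [G] is arbitrary, possibly negative. *)
Definition tangent_part G : M -> vec -> R :=
  fun p v => if `[< tangent p v >] then G p v else 0.

Lemma tangent_partE G p v : tangent p v -> tangent_part G p v = G p v.
Proof. by move=> pv; rewrite /tangent_part asboolT. Qed.

Lemma tangent_part_ge0 G p v : lagrangian G -> 0 <= tangent_part G p v.
Proof.
by move=> lG; rewrite /tangent_part; case: asboolP => // /(lagrangian_ge0 lG).
Qed.

Lemma tangent_part_lagrangian G : lagrangian G -> lagrangian (tangent_part G).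
Proof.
move=> lG; split.
- move=> i p w ip; rewrite tangent_partE; last exact: tangent_tvec.
  have nip : \forall q \near (p, w), dom i q.1.
    by apply: (@cvg_fst _ _ (nbhs p) (nbhs w)); exact: nbhs_dom.
  apply: cvg_trans (lagrangian_cvg lG ip); apply: near_eq_cvg.
  by apply: filterS nip => q iq; rewrite tangent_partE//; exact: tangent_tvec.
- by move=> p v pv; exact: tangent_part_ge0.
- move=> p a v a0 pv; rewrite (tangent_partE _ pv).
  have pav : tangent p (a *: v).
    move: pv => [v1 v2]; split=> [j nj|j k jp kp].
      by rewrite [LHS](_ : _ = a *: v j)// v1// scaler0.
    rewrite [LHS](_ : _ = a *: v k)// [X in 'd _ _ X](_ : _ = a *: v j)//.
    by rewrite linearZ /= -v2.
  by rewrite tangent_partE// (lagrangian_homogeneous lG a0 pv).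
- by move=> p v pv; rewrite tangent_partE//; exact: (lagrangian_eq0 lG pv).
Qed.

Lemma flength_tangent_part G a b beta : lagrangian G -> piecewise_C1 a b beta ->
  flength G a b beta = flength (tangent_part G) a b beta.
Proof.
move=> lG pb; apply: ae_eq_integral => //.
- by apply/measurable_EFinP; exact: (piecewise_C1_measurable lG pb).
- apply/measurable_EFinP.
  exact: (piecewise_C1_measurable (tangent_part_lagrangian lG) pb).
have := piecewise_C1_tangent pb.
apply: filterS; first exact: (ae_filter_ringOfSetsType lambda).
by move=> s Hs; rewrite /= in_itv => /Hs /tangent_partE ->.
Qed.

End Length.

(** * A Dini criterion for lower bounds on integrals *)

Section DiniIntegral.
Context (R : realType).
Local Notation lambda := (@lebesgue_measure R).

(** [dini_le] with the indefinite integral of [f] as [V]: a bound [m <= f] just to the right of [s]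
    makes it grow at least at rate [m]. Thus [r] may be merely lower semicontinuous, and no
    derivative of [r] is taken. *)
Lemma dini_le_integral (f r : R -> R) (a b : R) : a < b ->
  measurable_fun `[a, b]%classic f -> (forall s, 0 <= f s) ->
  (forall s, a < s <= b -> forall e, 0 < e -> exists2 d, 0 < d &
     forall u, a <= u <= b -> `|s - u| < d -> r s <= r u + e) ->
  (forall s, a <= s < b -> forall e, 0 < e -> exists2 d, 0 < d &
     exists2 m, 0 <= m & (forall u, s < u < s + d -> u < b -> m <= f u) /\
       (forall u, s < u < s + d -> u <= b -> r u - r s <= (m + e) * (u - s))) ->
  ((r b - r a)%:E <= \int[lambda]_(s in `[a, b]) (f s)%:E)%E.
Proof.
move=> ab mf f0 lsc right.
have mEf : measurable_fun `[a, b]%classic (EFin \o f) by exact/measurable_EFinP.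
have f0E s : (0 <= (EFin \o f) s)%E by rewrite lee_fin.
pose J (i : interval R) := (\int[lambda]_(s in [set` i]) (EFin \o f) s)%E.
have subJ (i j : interval R) : [set` i] `<=` [set` j] ->
    [set` j] `<=` `[a, b] -> (J i <= J j)%E.
  move=> ij jab; apply: ge0_subset_integral => //.
  exact: measurable_funS mEf.
have J0 i : (0 <= J i)%E by exact: integral_ge0.
rewrite -/(J `[a, b]).
have [->|Jfin] := eqVneq (J `[a, b]) +oo%E; first exact: leey.
have finJ i : [set` i] `<=` `[a, b] -> J i \is a fin_num.
  move=> iab; rewrite ge0_fin_numE//; apply: (le_lt_trans (subJ _ _ iab _)) => //.
  by rewrite ltey.
have subc u : u <= b -> [set` `[a, u]] `<=` `[a, b].
  by move=> ub s /=; rewrite !in_itv /=; lra.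
have JD s u : a <= s -> s <= u -> u <= b ->
    (J `[a, u] = J `[a, s] + J `]s, u])%E.
  move=> a_s su ub; rewrite /J.
  have <- : `[a, s] `|` `]s, u] = `[a, u]%classic.
    by apply/seteqP; split=> x /=; rewrite !in_itv /=; [|case: (leP x s)]; lra.
  apply: ge0_integral_setU => //.
    apply: measurable_funS mEf => //.
    by move=> x /=; rewrite !in_itv /=; lra.
  by apply/disj_setPS => x /=; rewrite !in_itv /=; lra.
have subo s u : a <= s -> u <= b -> [set` `]s, u]] `<=` `[a, b].
  by move=> a_s ub x /=; rewrite !in_itv /=; lra.
rewrite -(fineK (finJ `[a, b] (subc b (lexx b)))) lee_fin.
suff : r b - r a <= fine (J `[a, b]) - fine (J `[a, a]).
  have : 0 <= fine (J `[a, a]) by rewrite fine_ge0.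
  by lra.
apply: (dini_le (V := fun s => fine (J `[a, s]))); first exact: ltW.
- move=> s sab e e0; have [d d0 Hd] := lsc s sab e e0; exists d => // u su au.
  by apply: Hd; [lra|rewrite ger0_norm; lra].
- move=> x y ax xy yb; apply: fine_le.
  + by apply/finJ/subc; exact: le_trans yb.
  + exact/finJ/subc.
  + apply: subJ; last exact: subc.
    by move=> u /=; rewrite !in_itv /=; lra.
- move=> s /andP[a_s sb] e e0.
  have [|d d0 [m m0 [mf' rm]]] := right s _ e e0; first by rewrite a_s.
  exists d => // u su ub; have := rm u su ub.
  have su' : s <= u by lra.
  have : m * (u - s) <= fine (J `[a, u]) - fine (J `[a, s]).
    rewrite (JD s u)// fineD; last 2 first.
    - by apply/finJ/subc; lra.
    - exact/finJ/subo.
    rewrite addrAC subrr add0r -lee_fin fineK; last exact/finJ/subo.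
    have <- : (\int[lambda]_(x in `]s, u[) (cst m%:E x) = (m * (u - s))%:E)%E.
      rewrite integral_cst//= (lebesgue_measure_itv `]s, u[)/= lte_fin.
      by rewrite ifT; [rewrite EFinM|lra].
    apply: (@le_trans _ _ (J `]s, u[)).
      apply: ge0_le_integral => //.
      - apply: measurable_funS mEf => //.
        by move=> x /=; rewrite !in_itv /=; lra.
      - by move=> x /=; rewrite in_itv /= => xsu; rewrite lee_fin mf'//; lra.
    apply: subJ; last exact: subo.
    by move=> x /=; rewrite !in_itv /=; lra.
  lra.
Qed.

End DiniIntegral.

(** * A capped norm in a chart bounds lengths from below *)

Section LowerBound.
Context (R : realType) (n : nat) (M : smoothManifold R n).
Local Notation vec := (chart_index M -> 'rV[R]_n).
Local Notation lambda := (@lebesgue_measure R).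
Context (G : M -> vec -> R) (lG : lagrangian G) (i : chart_index M).
Context (P : 'rV[R]_n -> R) (C : R) (O : set M) (x0 : M) (kappa : R).
Hypothesis P_subadditive : forall w1 w2, P (w1 + w2) <= P w1 + P w2.
Hypothesis P_homogeneous : homogeneous P.
Hypothesis P_ge0 : forall w, 0 <= P w.
Hypothesis C_gt0 : 0 < C.
Hypothesis P_upper : forall w, P w <= C * `|w|.
Hypothesis O_open : open O.
Hypothesis O_dom : O `<=` dom i.
Hypothesis P_le : forall q w, O q -> P w <= G q (tvec i q w).
Hypothesis kappa_gt0 : 0 < kappa.
Hypothesis sublevel_closed : forall alpha, alpha < kappa ->
  closed [set y | O y /\ P (chart i y - chart i x0) <= alpha].

(* Capping at [kappa], and setting the value [kappa] outside [O], makes this a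
   function on all of [M] to which the Dini argument applies along any path: no
   discussion of paths that leave [O] is needed. *)
Definition truncated_distance (y : M) : R :=
  if `[< O y >] then Num.min (P (chart i y - chart i x0)) kappa else kappa.

Local Notation rho := truncated_distance.

Let rho_le y : rho y <= kappa.
Proof. by rewrite /rho; case: ifP => // _; rewrite ge_min lexx orbT. Qed.

Let rho_leO y : O y -> rho y <= P (chart i y - chart i x0).
Proof. by move=> Oy; rewrite /rho asboolT// ge_min lexx. Qed.

(** The sublevel sets are closed in all of [M], not only in [O]. Hence points of value below
    [kappa - e] cannot accumulate at a point outside [O], where the value is [kappa]. *)
Lemma truncated_distance_lsc y e : 0 < e ->
  \forall y' \near y, rho y <= rho y' + e.
Proof.
move=> e0; have ak : rho y - e < kappa by have := rho_le y; lra.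
have : open (~` [set y' | O y' /\ P (chart i y' - chart i x0) <= rho y - e]).
  by rewrite openC; exact: sublevel_closed.
move=> oA; have : nbhs y (~` [set y' | O y' /\
    P (chart i y' - chart i x0) <= rho y - e]).
  apply: open_nbhs_nbhs; split => // -[Oy Py].
  by have := rho_leO Oy; lra.
apply: filterS => y' /= NA; rewrite {2}/truncated_distance.
case: asboolP => Oy'; last by have := rho_le y; lra.
rewrite -lerBlDr le_min; apply/andP; split; last exact: ltW.
by rewrite leNgt; apply/negP => /ltW ?; exact: NA.
Qed.

Let P_continuous w w' : `|P w - P w'| <= C * `|w - w'|.
Proof.
have H u v : P u - P v <= C * `|u - v|.
  have := P_subadditive (u - v) v; rewrite subrK.
  by have := P_upper (u - v); lra.
by have := H w w'; have := H w' w; rewrite ler_norml [`|w' - w|]distrC; lra.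
Qed.

Lemma truncated_distance_C1 a b beta : a < b -> C1_on a b beta ->
  measurable_fun `[a, b]%classic
    (fun s => tangent_part G (beta s) (velocity beta s)) ->
  ((rho (beta b) - rho (beta a))%:E <=
    \int[lambda]_(s in `[a, b]) (tangent_part G (beta s) (velocity beta s))%:E)%E.
Proof.
move=> ab cb mf; have [/within_continuousP cbeta _] := cb.
apply: (dini_le_integral (r := rho \o beta)) => //.
- by move=> s; exact: tangent_part_ge0.
- move=> s /andP[a_s sb] e e0.
  have [|d d0 Hd] := cbeta s _ _ (truncated_distance_lsc (beta s) e0).
    by rewrite /= in_itv /= sb ltW.
  by exists d => // u uab; apply: Hd; rewrite /= in_itv.
move=> s /andP[a_s sb] e e0; have sab : a <= s <= b by lra.
(* Outside [O] the function is at its maximum, so it cannot increase and [m = 0] will do. *)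
have [Os|NOs] := pselect (O (beta s)); last first.
  exists 1 => //; exists 0 => //; split=> [u _ _|u su ub].
    exact: tangent_part_ge0.
  have rE : rho (beta s) = kappa by rewrite /rho asboolF.
  have : 0 <= (0 + e) * (u - s) by rewrite add0r mulr_ge0; lra.
  by rewrite /=; have := rho_le (beta u); lra.
have [w [dw cw qw]] := C1_on_chart i cb.
have is_ := O_dom Os.
(* Through the Lipschitz constant [C] of [P], both the variation of the derivative [w] and the first
   order remainder of the path then cost at most [e / 4]. *)
pose eta := e / (4 * C).
have eta0 : 0 < eta by rewrite divr_gt0// mulr_gt0.
have Ceta : C * eta = e / 4 by rewrite /eta; field; rewrite gt_eqF.
have [d1 d10 H1] := cw s eta sab is_ eta0.
have [d2 d20 H2] := qw s eta sab is_ eta0.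
have [||d3 d30 H3] := cbeta s _ O; [by rewrite /= in_itv| |].
  by apply: open_nbhs_nbhs.
pose d := Num.min d1 (Num.min d2 d3).
have d0 : 0 < d by rewrite !lt_min d10 d20.
(* The speed near [s] is at least [P (w s) - e / 4]; the maximum with 0 meets the requirement
   [0 <= m]. *)
exists d => //; exists (Num.max 0 (P (w s) - e / 4)); first by rewrite le_max lexx.
have close u : s < u < s + d -> [/\ `|s - u| < d1, `|s - u| < d2 & `|s - u| < d3].
  move=> su; have : `|s - u| < d by rewrite ltr_norml; lra.
  by rewrite !lt_min => /and3P.
split=> [u su ub|u su ub].
  have [su1 su2 su3] := close u su.
  have uab : a < u < b by lra.
  have uab' : a <= u <= b by lra.
  have Ou : O (beta u) by apply: H3 => //; rewrite /= in_itv.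
  have [_ wu] := H1 u uab' su1.
  have iu := O_dom Ou.
  rewrite (C1_on_velocity cb uab iu (dw u uab iu)) ge_max.
  rewrite tangent_part_ge0//= tangent_partE; last exact: tangent_tvec.
  apply: le_trans (P_le _ Ou).
  have := P_continuous (w u) (w s); rewrite ler_norml => /andP[+ _].
  by have := ler_wpM2l (ltW C_gt0) wu; rewrite Ceta; lra.
have [su1 su2 su3] := close u su.
have uab' : a <= u <= b by lra.
have Ou : O (beta u) by apply: H3 => //; rewrite /= in_itv.
have us0 : 0 < u - s by lra.
have step : P (chart i (beta u) - chart i (beta s)) <= (P (w s) + e / 4) * (u - s).
  have := H2 u uab' su2; rewrite (gtr0_norm us0).
  set D := chart i (beta u) - chart i (beta s) => HD.
  have := P_subadditive (D - (u - s) *: w s) ((u - s) *: w s).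
  rewrite subrK P_homogeneous; last exact: ltW.
  have := P_upper (D - (u - s) *: w s).
  have := ler_wpM2l (ltW C_gt0) HD; rewrite mulrA Ceta; lra.
have tri : rho (beta u) <= rho (beta s) + P (chart i (beta u) - chart i (beta s)).
  rewrite {2}/truncated_distance asboolT//.
  have := rho_leO Ou; have := rho_le (beta u).
  have := P_subadditive (chart i (beta u) - chart i (beta s))
    (chart i (beta s) - chart i x0).
  rewrite addrA subrK; have := P_ge0 (chart i (beta u) - chart i (beta s)).
  by rewrite /Num.min; case: ifP => _; lra.
have m1 : P (w s) - e / 4 <= Num.max 0 (P (w s) - e / 4) by rewrite le_max lexx orbT.
have : (P (w s) + e / 4) * (u - s) <= (Num.max 0 (P (w s) - e / 4) + e) * (u - s).
  by rewrite ler_pM2r//; lra.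
by rewrite /=; lra.
Qed.

Lemma truncated_distance_flength a b beta : piecewise_C1 a b beta ->
  ((rho (beta b) - rho (beta a))%:E <= flength G a b beta)%E.
Proof.
move=> pb; rewrite (flength_tangent_part lG pb) /flength.
have lT := tangent_part_lagrangian lG.
have mf := piecewise_C1_measurable lT pb.
move: pb mf => [m [t [<- <- Ht]]] mf; move: mf.
pose I x y := (\int[lambda]_(s in `[x, y])
  (tangent_part G (beta s) (velocity beta s))%:E)%E.
rewrite -/(I _ _).
apply: (partition_induction (P := fun x y =>
  measurable_fun `[x, y]%classic (fun s => tangent_part G (beta s) (velocity beta s)) ->
  ((rho (beta y) - rho (beta x))%:E <= I x y)%E)) => [k km|x y z xy yz Hxy Hyz mf].
  by have [tk cb] := Ht k km; split => // mf; exact: truncated_distance_C1.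
have mxy : measurable_fun `[x, y]%classic
    (fun s => tangent_part G (beta s) (velocity beta s)).
  apply: measurable_funS mf => // u /=; rewrite !in_itv /=; lra.
have myz : measurable_fun `[y, z]%classic
    (fun s => tangent_part G (beta s) (velocity beta s)).
  apply: measurable_funS mf => // u /=; rewrite !in_itv /=; lra.
have -> : I x z = (I x y + I y z)%E.
  rewrite /I -[X in _ = (X + _)%E]integral_itv_bndo_bndc; last first.
    apply/measurable_EFinP; apply: measurable_funS mxy => // u /=.
    by rewrite !in_itv /=; lra.
  have <- : `[x, y[ `|` `[y, z] = `[x, z]%classic.
    by apply/seteqP; split=> u /=; rewrite !in_itv /=; [|case: (leP y u)]; lra.
  apply: ge0_integral_setU => //.
  - apply/measurable_EFinP; apply: measurable_funS mf => // u /=.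
    by rewrite !in_itv /=; lra.
  - by move=> u _; rewrite lee_fin; exact: tangent_part_ge0.
  - by apply/disj_setPS => u /=; rewrite !in_itv /=; lra.
apply: le_trans (leeD (Hxy mxy) (Hyz myz)).
by rewrite -EFinD lee_fin; lra.
Qed.

Lemma dist_lower_bound y : O x0 -> ((rho y)%:E <= dist G x0 y)%E.
Proof.
move=> Ox0; apply: le_ereal_inf_tmp => _ [a [b [beta [ab pb bx by_ ->]]]].
have := truncated_distance_flength pb; rewrite bx by_.
have -> : rho x0 = 0.
  rewrite /rho asboolT// subrr homogeneous0// min_l//; exact: ltW.
by rewrite subr0.
Qed.

End LowerBound.

(** * Lower bounds for distances near a point *)

Section LocalLowerBounds.
Context (R : realType) (n : nat) (M : smoothManifold R n).
Local Notation vec := (chart_index M -> 'rV[R]_n).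
Implicit Types (p q : M) (i : chart_index M) (w : 'rV[R]_n).

Definition chart_ball i p (r : R) : set M :=
  [set q | dom i q /\ `|chart i q - chart i p| < r].

Lemma chart_ball_nbhs i p r : dom i p -> 0 < r -> nbhs p (chart_ball i p r).
Proof.
move=> ip r0; have cp : chart i q @[q --> p] --> chart i p by exact: chart_cvg.
have /cvgrPdist_lt/(_ r r0) := cp.
by apply: filterS2 (nbhs_dom ip) => q iq; rewrite distrC.
Qed.

Lemma chart_ball_open i p r : open (chart_ball i p r).
Proof.
rewrite openE => q [iq qr].
have r'0 : 0 < r - `|chart i q - chart i p| by rewrite subr_gt0.
apply: filterS (chart_ball_nbhs iq r'0) => q' [iq' q'q]; split => //.
have := ler_distD (chart i q) (chart i q') (chart i p); lra.
Qed.

(** The last clause places a full coordinate ball inside the image of the chart, so that segments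
    and sublevel sets drawn in coordinates can be pulled back to [M]. *)
Lemma chart_ballP i p (A : set M) : dom i p -> nbhs p A ->
  exists r, [/\ 0 < r, chart_ball i p r `<=` A &
    forall u, `|u - chart i p| < r ->
      dom i (chartV i u) /\ chart i (chartV i u) = u].
Proof.
move=> ip pA.
have : \forall u \near chart i p, [/\ A (chartV i u), dom i (chartV i u) &
    chart i (chartV i u) = u].
  by apply: filterS2 (near_chartV ip pA) (near_chart_image ip) => u ? [].
move=> /nbhs_ballP[r /= r0 Hr]; exists r; split=> //.
  move=> q [iq qr]; have [|+ _ _] := Hr (chart i q).
    by rewrite -ball_normE /= distrC.
  by rewrite (chartVK iq).
by move=> u ur; have [|_ ? ?] := Hr u; first by rewrite -ball_normE /= distrC.
Qed.

(** The cap comes from the radius: a value of [P] below [c * (r / 2)] means a coordinate distance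
    below [r / 2] from [x0], hence a point still in the ball of radius [r]. So a sublevel set below
    the cap is the image under [chartV i] of a compact set, and it is closed because [M] is
    Hausdorff. *)
Lemma dist_ge_min (G : M -> vec -> R) i p r c C (P : 'rV[R]_n -> R) x0 y :
  lagrangian G -> dom i p -> 0 < r -> 0 < c -> 0 < C ->
  (forall u, `|u - chart i p| < r ->
     dom i (chartV i u) /\ chart i (chartV i u) = u) ->
  (forall w1 w2, P (w1 + w2) <= P w1 + P w2) -> homogeneous P ->
  (forall w, c * `|w| <= P w) -> (forall w, P w <= C * `|w|) ->
  (forall q w, chart_ball i p r q -> P w <= G q (tvec i q w)) ->
  chart_ball i p (r / 2) x0 -> chart_ball i p r y ->
  ((Num.min (P (chart i y - chart i x0)) (c * (r / 2)))%:E <= dist G x0 y)%E.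
Proof.
move=> lG ip r0 c0 C0 img Padd Phom Plow Pup PG [ix0 x0r] Oy.
have P0 w : 0 <= P w by apply: le_trans (Plow w); rewrite mulr_ge0// ltW.
have k0 : 0 < c * (r / 2) by rewrite mulr_gt0//; lra.
have Ox0 : chart_ball i p r x0 by split => //; lra.
have := @dist_lower_bound R n M G lG i P C (chart_ball i p r) x0 (c * (r / 2))
  Padd Phom P0 C0 Pup (chart_ball_open _ _ _) _ PG k0 _ y Ox0.
rewrite {1}/truncated_distance asboolT//; apply; first by move=> q [].
move=> alpha ak.
pose K : set 'rV[R]_n := [set u | P (u - chart i x0) <= alpha].
have Kr u : K u -> `|u - chart i p| < r.
  move=> Ku; have : c * `|u - chart i x0| < c * (r / 2).
    exact: le_lt_trans (le_trans (Plow _) Ku) ak.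
  rewrite ltr_pM2l// => ur.
  have := ler_distD (chart i x0) u (chart i p); lra.
have Pcont (u : 'rV[R]_n) : (fun v : 'rV[R]_n => P (v - chart i x0)) @ nbhs u -->
      P (u - chart i x0).
  apply/cvgrPdist_lt => e e0.
  have eC : 0 < e / C by exact: divr_gt0.
  have : \forall v \near u, `|u - v| < e / C.
    by have /cvgrPdist_lt/(_ _ eC) := @cvg_id _ (nbhs u).
  apply: filterS => v uv.
  have h w1 w2 : P w1 <= P w2 + C * `|w1 - w2|.
    have := Padd (w1 - w2) w2; rewrite subrK; have := Pup (w1 - w2); lra.
  have h1 := h (u - chart i x0) (v - chart i x0).
  have h2 := h (v - chart i x0) (u - chart i x0).
  have e1 : u - chart i x0 - (v - chart i x0) = u - v by rewrite opprB addrA subrK.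
  have e2 : v - chart i x0 - (u - chart i x0) = v - u by rewrite opprB addrA subrK.
  have := uv; rewrite ltr_pdivlMr// mulrC => uvC.
  by move: h1 h2; rewrite e1 e2 [`|v - u|]distrC ltr_norml; lra.
have cK : compact K.
  apply: bounded_closed_compact.
    exists (`|chart i p| + r); split; first exact: num_real.
    move=> x xr u /Kr ur; apply/ltW/(le_lt_trans _ xr).
    have := ler_distD (chart i p) u 0; rewrite !subr0; lra.
  apply: (@preimage_closed _ _ (fun u : 'rV[R]_n => P (u - chart i x0))
    [set x | x <= alpha]).
    by move=> u _; exact: Pcont.
  exact: closed_le.
have -> : [set y' | chart_ball i p r y' /\ P (chart i y' - chart i x0) <= alpha]
    = chartV i @` K.
  apply/seteqP; split=> [y' [[iy' _] Py']|_ [u Ku <-]].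
    by exists (chart i y') => //; rewrite (chartVK iy').
  have [iu uE] := img u (Kr u Ku); split; last by rewrite uE.
  by split=> //; rewrite uE; exact: Kr.
apply: compact_closed; first exact: carrier_hausdorff.
apply: continuous_compact => //; apply: continuous_in_subspaceT => u.
rewrite inE => Ku; have [iu uE] := img u (Kr u Ku).
by apply: chartV_continuous; rewrite inE -uE; exists (chartV i u).
Qed.

Lemma dist_ge_norm (G : M -> vec -> R) i p : lagrangian G -> dom i p ->
  exists c r, [/\ 0 < c, 0 < r & forall q q', chart_ball i p r q ->
    chart_ball i p r q' ->
    ((c * `|chart i q' - chart i q|)%:E <= dist G q q')%E].
Proof.
move=> lG ip; have [c c0 Hc] := lagrangian_lower lG ip.
have [r [r0 rc img]] := chart_ballP ip Hc.
(* Two points of the ball of radius [r / 4] are less than [r / 2] apart, so the cap of [dist_ge_min]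
   is not reached. *)
exists c, (r / 4); split=> //; first lra.
move=> q q' [iq qr] [iq' q'r].
have := @dist_ge_min G i p r c c (fun w => c * `|w|) q q' lG ip r0 c0 c0 img.
rewrite min_l; first apply => //.
- by move=> w1 w2; rewrite -mulrDr ler_pM2l// ler_normD.
- by move=> a w a0; rewrite normrZ ger0_norm// mulrCA.
- by move=> x w /rc; apply.
- by split=> //; lra.
- by split=> //; lra.
rewrite ler_pM2l//; have := ler_distD (chart i p) (chart i q') (chart i q).
by rewrite [`|chart i p - _|]distrC; lra.
Qed.

(** [P] is [F] frozen at [p] and shrunk by [1 - e]. Near [p] the structure [F] changes by at most
    [e * c] times the norm of the vector, and [c] times that norm is at most its value at [p]; so
    [P] stays below [F]. *)
Lemma dist_ge_finsler (F : M -> vec -> R) i p e : finsler_structure F ->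
  dom i p -> 0 < e < 1 ->
  \forall q \near p,
    (((1 - e) * F p (tvec i p (chart i q - chart i p)))%:E <= dist F p q)%E.
Proof.
move=> hF ip /andP[e0 e1]; have lF := finsler_lagrangian hF.
have [c c0 Hc] := lagrangian_lower lF ip.
have [C C0 HC] := lagrangian_upper lF ip.
have ec0 : 0 < e * c by exact: mulr_gt0.
have Hclose := lagrangian_close lF ip ec0.
have [r [r0 rH img]] := chart_ballP ip Hclose.
have {}Hc := nbhs_singleton Hc; have {}HC := nbhs_singleton HC.
pose P w := (1 - e) * F p (tvec i p w).
have e1' : 0 < 1 - e by rewrite subr_gt0.
have Pup w : P w <= (1 - e) * C * `|w| by rewrite /P -mulrA ler_pM2l.
have Plow w : (1 - e) * c * `|w| <= P w by rewrite /P -mulrA ler_pM2l.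
(* The first term keeps [q] in the ball, the second keeps [P] below the cap. *)
pose r' := Num.min (r / 2) (c * (r / 2) / C).
have r'0 : 0 < r' by rewrite lt_min !divr_gt0// mulr_gt0// divr_gt0.
apply: filterS (chart_ball_nbhs ip r'0) => q [iq]; rewrite lt_min => /andP[qr1 qr2].
have := @dist_ge_min F i p r ((1 - e) * c) ((1 - e) * C) P p q lF ip r0.
rewrite min_l; first apply => //.
- exact: mulr_gt0.
- exact: mulr_gt0.
- move=> w1 w2; rewrite /P -mulrDr ler_pM2l// tvecD.
  by apply: (finsler_subadditive hF); exact: tangent_tvec.
- move=> a w a0; rewrite /P tvecZ.
  by rewrite (finsler_homogeneous hF a0 (tangent_tvec w ip)) mulrCA.
- move=> x w Ox; have := rH x Ox w; have := ler_wpM2l (ltW e0) (Hc w).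
  rewrite /P ler_norml; move: (F x _) (F p _) `|w| => y z v; clear; lra.
- by split=> //; rewrite subrr normr0; lra.
- by split=> //; lra.
apply: (le_trans (Pup _)); rewrite -!mulrA ler_pM2l//.
by move: qr2; rewrite ltr_pdivlMr// mulrC => /ltW.
Qed.

End LocalLowerBounds.

(** * First properties of the distance, and coordinate segments *)

Section DistBasics.
Context (R : realType) (n : nat) (M : smoothManifold R n).
Local Notation vec := (chart_index M -> 'rV[R]_n).
Local Notation lambda := (@lebesgue_measure R).
Implicit Types (G : M -> vec -> R) (p q x y : M) (i j : chart_index M).
Implicit Types (beta : R -> M) (a b s u : R).

Lemma flength_ge0 G a b beta : lagrangian G -> piecewise_C1 a b beta ->
  (0 <= flength G a b beta)%E.
Proof.
move=> lG pb; rewrite (flength_tangent_part lG pb).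
by apply: integral_ge0 => s _; rewrite lee_fin; exact: tangent_part_ge0.
Qed.

Lemma dist_ge0 G x y : lagrangian G -> (0 <= dist G x y)%E.
Proof.
move=> lG; apply: le_ereal_inf_tmp => _ [a [b [beta [ab pb _ _ ->]]]].
exact: flength_ge0.
Qed.

Lemma dist_self G x : lagrangian G -> (dist G x x <= 0)%E.
Proof.
move=> lG; apply: ge_ereal_inf; exists (flength G 0 1 (fun=> x)).
  exists 0, 1, (fun=> x); split=> //; exists 0%N, (fun k => k%:R); split=> //.
  move=> k; rewrite leqn0 => /eqP ->; split; first by rewrite ltr01.
  split; first by move=> ?; exact: cvg_cst.
  move=> i; exists (fun=> 0); split=> [|s _ _]; first by move=> ?; exact: cvg_cst.
  under eq_cvg do rewrite subrr scaler0.
  exact: cvg_cst.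
rewrite /flength.
under eq_integral => s _.
  have -> : velocity (fun=> x) s = 0 :> vec.
    apply/funext => i; rewrite /velocity /comp derive1_cst.
    by case: ifP.
  have -> : G x 0 = 0.
    have := lagrangian_homogeneous lG (lexx 0) (tangent0 x).
    by rewrite scale0r mul0r.
  over.
by rewrite integral0.
Qed.

Lemma dist_scale_le G1 G2 c x y : lagrangian G1 -> lagrangian G2 -> 0 <= c ->
  (forall p v, tangent p v -> c * G1 p v <= G2 p v) ->
  (c%:E * dist G1 x y <= dist G2 x y)%E.
Proof.
move=> l1 l2 c0 H; apply: le_ereal_inf_tmp => _ [a [b [beta [ab pb bx by_ ->]]]].
have mT G : lagrangian G -> measurable_fun `[a, b]%classic
    (EFin \o (fun s => tangent_part G (beta s) (velocity beta s))).
  move=> lG; apply/measurable_EFinP.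
  exact: piecewise_C1_measurable (tangent_part_lagrangian lG) pb.
apply: (@le_trans _ _ (c%:E * flength G1 a b beta)%E).
  apply: lee_wpmul2l; first by rewrite lee_fin.
  by apply: ereal_inf_lbound; exists a, b, beta.
rewrite (flength_tangent_part l1 pb) (flength_tangent_part l2 pb) /flength.
rewrite -ge0_integralZl//; last 2 first.
- exact: mT.
- by move=> s _; rewrite lee_fin; exact: tangent_part_ge0.
apply: ge0_le_integral => //.
- by move=> s _; rewrite mule_ge0// lee_fin; exact: tangent_part_ge0.
- by apply: measurable_funeM; exact: mT.
- exact: mT.
move=> s _; rewrite -EFinM lee_fin /tangent_part.
by case: asboolP => [/H//|_]; rewrite mulr0.
Qed.

Lemma C1_on_congr a b beta beta' : (forall s, a <= s <= b -> beta' s = beta s) ->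
  C1_on a b beta -> C1_on a b beta'.
Proof.
move=> E [/within_continuousP cb H]; split.
  apply/within_continuousP => s sab A; rewrite E; last by move: sab; rewrite /= in_itv.
  move=> /(cb s sab)[d d0 Hd]; exists d => // u uab su; rewrite E.
    exact: Hd.
  by move: uab; rewrite /= in_itv.
move=> i; have [w [cw qw]] := H i; exists w.
have -> : `[a, b] `&` beta' @^-1` dom i = `[a, b] `&` beta @^-1` dom i.
  by apply/seteqP; split=> u [uab]; split=> //; move: uab; rewrite /= in_itv => /E;
    [move=> <-|move=> ->].
split=> // s sab; rewrite E// => is_; apply: cvg_trans (qw s sab is_).
apply: near_eq_cvg; apply: filterS (withinT _ _) => u uab.
by rewrite E//; move: uab; rewrite /= in_itv.
Qed.

(** In another chart the velocity is the derivative of the transition map in the direction [w]; its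
    continuity is the second half of class C^1 in [Ck_on]. The parameter starts at [b] so that the
    segment continues a path ending there. *)
Lemma C1_on_segment i (z w : 'rV[R]_n) b :
  (forall h, 0 <= h <= 1 ->
    dom i (chartV i (z + h *: w)) /\ chart i (chartV i (z + h *: w)) = z + h *: w) ->
  C1_on b (b + 1) (fun s => chartV i (z + (s - b) *: w)).
Proof.
move=> seg.
have img s : b <= s <= b + 1 -> dom i (chartV i (z + (s - b) *: w)) /\
    chart i (chartV i (z + (s - b) *: w)) = z + (s - b) *: w.
  by move=> sb; apply: seg; lra.
have zc s : z + (u - b) *: w @[u --> s] --> z + (s - b) *: w.
  apply: cvgD; first exact: cvg_cst.
  apply: cvgZr_tmp; apply: cvgB; [exact: cvg_id|exact: cvg_cst].
split.
  apply/subspace_continuousP => s; rewrite /= in_itv /= => sb.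
  have [iz zE] := img s sb.
  have cV : {for z + (s - b) *: w, continuous (@chartV _ _ M i)}.
    by apply: chartV_continuous; rewrite inE -zE; exists (chartV i (z + (s - b) *: w)).
  by apply: cvg_within_filter; exact: cvg_comp (zc s) cV.
move=> j; exists (fun s => 'D_w (chart j \o chartV i) (z + (s - b) *: w)).
have [Dj cDj] := @transition_smooth _ _ M i j 1.
have inU s : b <= s <= b + 1 -> dom j (chartV i (z + (s - b) *: w)) ->
    z + (s - b) *: w \in chart i @` (dom i `&` dom j).
  move=> sb js; have [iz zE] := img s sb.
  by rewrite inE; exists (chartV i (z + (s - b) *: w)).
split.
  apply/subspace_continuousP => s; rewrite /= in_itv /= => -[sb js].
  have cD : {for z + (s - b) *: w, continuous ('D_w (chart j \o chartV i))}.
    exact: (cDj w) (inU s sb js).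
  by apply: cvg_within_filter; exact: cvg_comp (zc s) cD.
move=> s sb js.
have dz : derivable (chart j \o chartV i) (z + (s - b) *: w) w.
  by apply: diff_derivable; exact: Dj (inU s sb js).
apply/cvgrPdist_le => e e0; have /cvgrPdist_le/(_ e e0) := dz.
move=> /nbhs_ballP[d /= d0 Hd]; apply/nbhs_ballP; exists d => //= u su us _.
have -> : z + (u - b) *: w = (u - s) *: w + (z + (s - b) *: w).
  by rewrite addrCA -scalerDl; congr (_ + _ *: _); lra.
have h1 : `|0 - (u - s)| < d by rewrite sub0r normrN distrC.
have h2 : u - s != 0 by rewrite subr_eq0.
exact: (Hd (u - s) h1 h2).
Qed.

End DistBasics.
Lemma near_eq_derive1 (R : numFieldType) (V : normedModType R) (f g : R -> V) x :
  (\forall u \near x, f u = g u) -> derive1 f x = derive1 g x.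
Proof. by move=> fg; rewrite !derive1E; exact: near_eq_derive. Qed.

Lemma is_derive_line (R : numFieldType) (V : normedModType R) (z w : V) (b s : R) :
  is_derive s 1 (fun u => z + (u - b) *: w) w.
Proof.
have H : h^-1 *: (((fun u => z + (u - b) *: w) \o shift s) (h *: 1) -
    (z + (s - b) *: w)) @[h --> 0^'] --> w.
  apply: cvg_near_cst; near=> h.
  have h0 : h != 0 by near: h; exact: nbhs_dnbhs_neq.
  rewrite /= opprD addrACA subrr add0r -scalerBl.
  have -> : h *: 1 + s - b - (s - b) = h by rewrite [h *: 1]mulr1; ring.
  by rewrite scalerA mulVf// scale1r.
by split; [apply/cvg_ex; exists w|exact/cvg_lim].
Unshelve. all: by end_near. Qed.

(** * Prolonging a path by a coordinate segment *)

Section Extension.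
Context (R : realType) (n : nat) (M : smoothManifold R n).
Local Notation vec := (chart_index M -> 'rV[R]_n).
Local Notation lambda := (@lebesgue_measure R).
Implicit Types (G : M -> vec -> R) (p q x y : M) (i j : chart_index M).
Implicit Types (beta sigma : R -> M) (a b c s u : R).

Definition concat b beta sigma : R -> M :=
  fun s => if s <= b then beta s else sigma s.

Lemma concat_left b beta sigma s : s <= b -> concat b beta sigma s = beta s.
Proof. by rewrite /concat => ->. Qed.

Lemma concat_right b beta sigma s : beta b = sigma b -> b <= s ->
  concat b beta sigma s = sigma s.
Proof.
rewrite /concat => bs; rewrite le_eqVlt => /predU1P[<-|]; first by rewrite lexx.
by rewrite ltNge => /negbTE ->.
Qed.

Lemma partition_le (t : nat -> R) m : (forall k, (k <= m)%N -> t k < t k.+1) ->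
  forall k, (k <= m.+1)%N -> t k <= t m.+1.
Proof.
elim: m => [|m IH] H k.
  case: k => [|[|k]]// _; exact/ltW/H.
rewrite leq_eqVlt => /predU1P[->//|]; rewrite ltnS => km.
apply: le_trans (ltW (H _ (leqnn _))); apply: IH => // l lm.
by apply: H; exact: leqW.
Qed.

Lemma piecewise_C1_concat a b c beta sigma : piecewise_C1 a b beta ->
  b < c -> C1_on b c sigma -> beta b = sigma b ->
  piecewise_C1 a c (concat b beta sigma).
Proof.
move=> [m [t [<- <- Ht]]] bc cs bs.
have tle := @partition_le t m (fun k km => (Ht k km).1).
exists m.+1, (fun k => if (k <= m.+1)%N then t k else c); split=> //.
  by rewrite ltnn.
move=> k km1; have [->|kn] := eqVneq k m.+1.
  rewrite /= leqnn ltnn; split => //; apply: C1_on_congr cs => s /andP[ts _].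
  exact: concat_right.
have km : (k <= m)%N by rewrite -ltnS ltn_neqAle kn.
rewrite /= km1 ltnS km; have [tk ck] := Ht k km.
split => //; apply: C1_on_congr ck => s /andP[_ st]; apply: concat_left.
exact: le_trans (tle k.+1 _).
Qed.

Lemma velocity_near_eq beta beta' s : (\forall u \near s, beta u = beta' u) ->
  velocity beta s = velocity beta' s.
Proof.
move=> E; apply/funext => i; rewrite /velocity (nbhs_singleton E).
rewrite (@near_eq_derive1 _ _ (chart i \o beta) (chart i \o beta') s) //.
by apply: filterS E => u uE; rewrite /comp uE.
Qed.

(** [velocity] depends only on the path near the parameter, so on either side of [b] it is that of
    the corresponding piece; the break points are a null set. *)
Lemma flength_concat_le G a b c beta sigma (K : R) : lagrangian G ->
  piecewise_C1 a b beta -> b < c -> C1_on b c sigma -> beta b = sigma b ->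
  0 <= K -> (forall s, b < s < c -> G (sigma s) (velocity sigma s) <= K) ->
  (flength G a c (concat b beta sigma) <=
   flength G a b beta + (K * (c - b))%:E)%E.
Proof.
move=> lG pb bc cs bs K0 HK.
have ab := piecewise_C1_lt pb.
have pc := piecewise_C1_concat pb bc cs bs.
have lT := tangent_part_lagrangian lG.
have mb := piecewise_C1_measurable lT pb.
have mc := piecewise_C1_measurable lT pc.
rewrite (flength_tangent_part lG pb) (flength_tangent_part lG pc) /flength.
pose f s := tangent_part G (beta s) (velocity beta s).
pose g s := tangent_part G (concat b beta sigma s)
  (velocity (concat b beta sigma) s).
rewrite -/f in mb; rewrite -/g in mc.
suff : (\int[lambda]_(s in `[a, c]) (g s)%:E <=
    \int[lambda]_(s in `[a, b]) (f s)%:E + (K * (c - b))%:E)%E by [].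
have g0 s : 0 <= g s by exact: tangent_part_ge0.
have <- : `[a, b[ `|` `[b, c] = `[a, c]%classic.
  apply/seteqP; split=> u /=; rewrite !in_itv /=; first by move: ab bc; clear; lra.
  by case: (leP b u); move: ab bc; clear; lra.
have mcE D : measurable D -> D `<=` `[a, c] ->
    measurable_fun D (fun s => (g s)%:E).
  by move=> mD Dac; apply/measurable_EFinP; exact: measurable_funS mc.
rewrite ge0_integral_setU//; last 3 first.
- apply: mcE; first exact: measurableU.
  move=> u /=; rewrite !in_itv /=; move: ab bc; clear; lra.
- by move=> u _; rewrite lee_fin.
- by apply/disj_setPS => u /=; rewrite !in_itv /=; lra.
apply: leeD.
  rewrite -[leRHS]integral_itv_bndo_bndc; last first.
    apply/measurable_EFinP; apply: measurable_funS mb => // u /=.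
    by rewrite !in_itv /=; lra.
  rewrite le_eqVlt; apply/orP; left; apply/eqP; apply: eq_integral => s.
  rewrite inE /= in_itv /= => /andP[a_s sb]; congr (_%:E).
  have E1 : concat b beta sigma s = beta s by exact/concat_left/ltW.
  have E2 : velocity (concat b beta sigma) s = velocity beta s.
    apply: velocity_near_eq; apply: filterS (lt_nbhsl sb) => u ub.
    exact/concat_left/ltW.
  by rewrite /g E1 E2.
have -> : (K * (c - b))%:E = (\int[lambda]_(s in `[b, c]) (cst K%:E s))%E.
  rewrite integral_cst//= (lebesgue_measure_itv `[b, c])/= lte_fin bc.
  by rewrite EFinM.
have ae_neq z : {ae lambda, forall s : R, s != z}.
  exists [set z]; split => //; first exact: lebesgue_measure_set1.
  by move=> s /= /negP; rewrite negbK => /eqP.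
have mg : measurable_fun `[b, c]%classic (fun s => (g s)%:E).
  by apply: (mcE) => // u /=; rewrite !in_itv /=; move: ab bc; clear; lra.
apply: ae_ge0_le_integral => //; first by move=> s _; rewrite lee_fin.
have aeF := ae_filter_ringOfSetsType lambda.
apply: filterS2 (ae_neq b) (ae_neq c) => s sb sc; rewrite /= in_itv /=.
move=> /andP[bs' sc']; have {}bs' : b < s by rewrite lt_neqAle eq_sym sb.
have {}sc' : s < c by rewrite lt_neqAle sc.
have bsc : b < s < c by rewrite bs'.
have E1 : concat b beta sigma s = sigma s by apply: concat_right => //; exact: ltW.
have E2 : velocity (concat b beta sigma) s = velocity sigma s.
  apply: velocity_near_eq; apply: filterS (lt_nbhsr bs') => u ub.
  by apply: concat_right => //; exact: ltW.
rewrite lee_fin /g E1 E2 (tangent_partE _ (tangent_velocity cs bsc)).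
exact: HK.
Qed.

(** The segment is run through in unit time, so a bound [K] on its speed is also a bound on its
    length. *)
Lemma dist_extend G i x q q' (K : R) : lagrangian G -> dom i q -> dom i q' ->
  0 <= K ->
  (forall h, 0 <= h <= 1 ->
    let u := chart i q + h *: (chart i q' - chart i q) in
    [/\ dom i (chartV i u), chart i (chartV i u) = u &
        G (chartV i u) (tvec i (chartV i u) (chart i q' - chart i q)) <= K]) ->
  (dist G x q' <= dist G x q + K%:E)%E.
Proof.
move=> lG iq iq' K0 seg; set w := chart i q' - chart i q in seg *.
rewrite -leeBlDr//; apply: le_ereal_inf_tmp => _ [a [b [beta [ab pb bx bq ->]]]].
rewrite leeBlDr//.
pose sigma s := chartV i (chart i q + (s - b) *: w).
have segi h : 0 <= h <= 1 -> dom i (chartV i (chart i q + h *: w)) /\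
    chart i (chartV i (chart i q + h *: w)) = chart i q + h *: w.
  by move=> /seg[].
have cs : C1_on b (b + 1) sigma by exact: C1_on_segment.
have bs : beta b = sigma b.
  by rewrite bq /sigma subrr scale0r addr0 (chartVK iq).
have b1 : b < b + 1 by rewrite ltrDl.
have HK s : b < s < b + 1 -> G (sigma s) (velocity sigma s) <= K.
  move=> sb; have sb' : 0 <= s - b <= 1 by move: sb; clear; lra.
  have [is_ sE GK] := seg _ sb'.
  have nab : \forall u \near s, b < u < b + 1.
    by apply: near_in_itvoo; rewrite in_itv.
  have dw : is_derive s 1 (chart i \o sigma) w.
    apply: near_eq_is_derive (is_derive_line (chart i q) w b s).
    apply: filterS nab => u ub; have ub' : 0 <= u - b <= 1 by move: ub; clear; lra.
    by have [_ uE] := segi _ ub'; rewrite /comp uE.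
  by rewrite (velocity_tvec is_ (C1_on_near_dom cs sb is_) dw).
have bb1 : b + 1 - b = 1 by ring.
have := flength_concat_le lG pb b1 cs bs K0 HK.
rewrite bb1 mulr1; apply: le_trans.
apply: ereal_inf_lbound; exists a, (b + 1), (concat b beta sigma); split => //.
- exact: lt_trans b1.
- exact: piecewise_C1_concat.
- by rewrite (concat_left _ _ (ltW ab)).
rewrite (concat_right bs (ltW b1)) /sigma bb1 scale1r /w addrC subrK.
exact: chartVK.
Qed.

End Extension.

(** * Comparison along a path *)

Section LocalExtension.
Context (R : realType) (n : nat) (M : smoothManifold R n).
Local Notation vec := (chart_index M -> 'rV[R]_n).
Implicit Types (F : M -> vec -> R) (p q x : M) (i : chart_index M).

Lemma norm_segment (z z0 z1 : 'rV[R]_n) r h : `|z0 - z| < r -> `|z1 - z| < r ->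
  0 <= h <= 1 -> `|z0 + h *: (z1 - z0) - z| < r.
Proof.
move=> z0r z1r /andP[h0 h1].
have -> : z0 + h *: (z1 - z0) - z = (1 - h) *: (z0 - z) + h *: (z1 - z).
  rewrite scalerBl scale1r -[RHS]addrA [- _ + _]addrC -scalerBr.
  by rewrite opprB addrA subrK addrAC.
apply: le_lt_trans (ler_normD _ _) _; rewrite !normrZ (ger0_norm h0).
rewrite ger0_norm ?subr_ge0//.
move: z0r z1r; set A := `|z0 - z|; set B := `|z1 - z| => Ar Br.
have [->|h0'] := eqVneq h 0; first by rewrite subr0 mul1r mul0r addr0.
have : h * B < h * r by rewrite ltr_pM2l// lt_neqAle eq_sym h0'.
have : (1 - h) * A <= (1 - h) * r by rewrite ler_wpM2l ?subr_ge0// ltW.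
by clear; lra.
Qed.

(** The crude Lipschitz version, uniform on a ball: it provides finiteness and the domination by
    coordinate variation. The version at a single point below has the sharp leading term. *)
Lemma dist_extend_ball F i p : lagrangian F -> dom i p ->
  exists C r, [/\ 0 < C, 0 < r & forall x q q', chart_ball i p r q ->
    chart_ball i p r q' ->
    (dist F x q' <= dist F x q + (C * `|chart i q' - chart i q|)%:E)%E].
Proof.
move=> lF ip; have [C C0 HC] := lagrangian_upper lF ip.
have [r [r0 rH img]] := chart_ballP ip HC.
exists C, r; split=> // x q q' [iq qr] [iq' q'r].
apply: (dist_extend x lF iq iq') => [|h h01 /=].
  by rewrite mulr_ge0// ltW.
have [iu uE] := img _ (norm_segment qr q'r h01); split=> //.
by apply: rH; split=> //; rewrite uE; exact: norm_segment.
Qed.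

Lemma dist_extend_near F i q e : lagrangian F -> dom i q -> 0 < e ->
  \forall q' \near q, forall x, (dist F x q' <= dist F x q +
    (F q (tvec i q (chart i q' - chart i q)) + e * `|chart i q' - chart i q|)%:E)%E.
Proof.
move=> lF iq e0.
have [r [r0 rH img]] := chart_ballP iq (lagrangian_close lF iq e0).
apply: filterS (chart_ball_nbhs iq r0) => q' [iq' q'r] x.
have qr : `|chart i q - chart i q| < r by rewrite subrr normr0.
apply: (dist_extend x lF iq iq') => [|h h01 /=].
  by rewrite addr_ge0 ?mulr_ge0 ?(ltW e0)// (lagrangian_ge0 lF (tangent_tvec _ iq)).
have [iu uE] := img _ (norm_segment qr q'r h01); split=> //.
have Ou : chart_ball i q r (chartV i (chart i q + h *: (chart i q' - chart i q))).
  by split=> //; rewrite uE; exact: norm_segment.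
have := rH _ Ou (chart i q' - chart i q); rewrite ler_norml => /andP[_].
by rewrite lerBlDl addrC.
Qed.

End LocalExtension.

(** * Absolute continuity in coordinates *)

Section CoordinatesOfPaths.
Context (R : realType) (n : nat) (M : smoothManifold R n).
Local Notation vec := (chart_index M -> 'rV[R]_n).
Implicit Types (p q : M) (i : chart_index M) (w : 'rV[R]_n).

Lemma norm_coord_le w k : `|w 0 k| <= `|w|.
Proof.
rewrite [leRHS]/Num.Def.normr /= mx_normrE.
by apply/bigmax_geP; right => /=; exists (0, k).
Qed.

Lemma norm_le_sum_coord w :
  `|w| <= \sum_k `|delta_mx 0 k : 'rV[R]_n| * `|w 0 k|.
Proof.
rewrite {1}[w]row_sum_delta; apply: le_trans (ler_norm_sum _ _ _) _.
by apply: ler_sum => k _; rewrite normrZ mulrC.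
Qed.

(** On a small ball the Riemannian distance is at least [c] times the coordinate distance, so the
    [delta] that belongs to [c * e] serves for each coordinate. *)
Lemma abs_cont_coord i p (gamma : R -> M) : absolutely_continuous 0 1 gamma ->
  dom i p -> exists2 r, 0 < r & forall a b, 0 <= a -> a <= b -> b <= 1 ->
    (forall s, a <= s <= b -> chart_ball i p r (gamma s)) ->
    forall k, abs_cont ((fun s => chart i (gamma s) 0 k) \o clip a b).
Proof.
move=> [g hg ac] ip.
have [c [r [c0 r0 H]]] := dist_ge_norm (riemannian_lagrangian hg) ip.
exists r => // a b a0 ab b1 ball k; apply: abs_cont_clip => // e e0.
have [d d0 Hd] := ac (c * e) (mulr_gt0 c0 e0); exists d => // m l u lu triv len.
have lu' j : [/\ 0 <= l j, l j < u j & u j <= 1].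
  by have [? ? ?] := lu j; split=> //; [exact: le_trans a0 _|exact: le_trans b1].
have lt := Hd m l u lu' triv len.
rewrite -(ler_pM2l c0) -lee_fin; apply: le_trans (ltW lt).
rewrite mulr_sumr -sumEFin; apply: lee_sum => j _.
have [al lj ub] := lu j.
have bl : chart_ball i p r (gamma (l j)).
  by apply: ball; rewrite al (le_trans (ltW lj)).
have bu : chart_ball i p r (gamma (u j)).
  by apply: ball; rewrite ub andbT (le_trans al) ?ltW.
apply: le_trans (H _ _ bl bu); rewrite lee_fin ler_pM2l//.
have := norm_coord_le (chart i (gamma (u j)) - chart i (gamma (l j))) k.
by rewrite !mxE.
Qed.

End CoordinatesOfPaths.

(** * The first order comparison at a point of the path *)

Section InfinitesimalComparison.
Context (R : realType) (n : nat) (M : smoothManifold R n).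
Local Notation vec := (chart_index M -> 'rV[R]_n).
Implicit Types (p q x : M) (i : chart_index M) (w : 'rV[R]_n).

Lemma is_derive_near (V : normedModType R) (f : R -> V) (s : R) (w : V) (e : R) :
  is_derive s 1 f w -> 0 < e ->
  \forall u \near s, `|f u - f s - (u - s) *: w| <= e * `|u - s|.
Proof.
move=> [df dw] e0; have H : h^-1 *: ((f \o shift s) (h *: 1) - f s) @[h --> 0^'] --> w.
  by rewrite -dw.
have /cvgrPdist_le/(_ e e0) := H.
move=> /nbhs_ballP[d /= d0 Hd]; apply/nbhs_ballP; exists d => //= u su.
have [->|us] := eqVneq u s; first by rewrite !subrr scale0r subr0 !normr0 mulr0.
have us0 : u - s != 0 by rewrite subr_eq0.
have h1 : `|0 - (u - s)| < d by rewrite sub0r normrN distrC.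
have := Hd (u - s) h1 us0; rewrite /= [(u - s) *: 1]mulr1 subrK => H2.
rewrite -(ler_pM2l (_ : 0 < `|u - s|)) ?normr_gt0// -normrZ in H2.
move: H2; rewrite scalerBr scalerA divff// scale1r distrC.
by rewrite [e * _]mulrC.
Qed.

Lemma finsler_perturb (F : M -> vec -> R) i q w w' C : finsler_structure F ->
  dom i q -> (forall v, F q (tvec i q v) <= C * `|v|) ->
  F q (tvec i q w) <= F q (tvec i q w') + C * `|w - w'|.
Proof.
move=> hF iq HC; have -> : w = w' + (w - w') by rewrite addrC subrK.
rewrite tvecD; apply: le_trans (finsler_subadditive hF _ _) _.
- exact: tangent_tvec.
- exact: tangent_tvec.
by rewrite lerD2l [w' + _]addrC subrK; exact: HC.
Qed.

(** The arithmetic of the comparison. [N] and [N1] are the values of [F] and [F1] at the derivative,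
    [W] is its norm, and [A] and [B] are the values at the coordinate increment over time [h], whose
    norm is [D]. [E] is the norm of the first order remainder. The errors governed by [e1]
    (segment), [e2] (derivative) and [e3] (lower bound) each cost at most [h * (e / 4)]. *)
Lemma infinitesimal_estimate (c0 e N N1 A B r h D W C C1 e1 e2 e3 E : R) :
  0 <= c0 -> 0 < e -> 0 <= N1 -> N <= c0 * N1 -> 0 < h -> 0 < C -> 0 < C1 ->
  0 <= W -> 0 < e1 -> e1 * (W + 1) <= e / 4 -> 0 < e2 -> e2 <= 1 ->
  e2 * (C + c0 * C1) <= e / 4 -> 0 < e3 -> e3 < 1 -> e3 * (c0 * N1) <= e / 4 ->
  0 <= E -> E <= e2 * h -> D <= h * W + E ->
  A <= h * N + C * E -> h * N1 <= B + C1 * E -> (1 - e3) * B <= r ->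
  A + e1 * D <= c0 * r + e * h.
Proof.
move=> c00 e0 N10 NN1 h0 C0 C10 W0 e10 e1W e20 e21 e2C e30 e31 e3N E0 Eh DW AN NB Br.
have h1 : e1 * D <= e1 * (h * W + E) by rewrite ler_pM2l.
have h2 : e1 * (h * W + E) <= e1 * (h * (W + 1)).
  by rewrite ler_pM2l// mulrDr mulr1 lerD2l (le_trans Eh)// ler_piMl// ltW.
have h3 : h * (e1 * (W + 1)) <= h * (e / 4) by rewrite ler_pM2l.
have h4 : (C + c0 * C1) * E <= (C + c0 * C1) * (e2 * h).
  by rewrite ler_wpM2l// addr_ge0 ?mulr_ge0// ltW.
have h5 : h * (e2 * (C + c0 * C1)) <= h * (e / 4) by rewrite ler_pM2l.
have h6 : h * (e3 * (c0 * N1)) <= h * (e / 4) by rewrite ler_pM2l.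
have h7 : h * N <= h * (c0 * N1) by rewrite ler_pM2l.
have h8 : c0 * ((1 - e3) * B) <= c0 * r by rewrite ler_wpM2l.
have h9 : c0 * ((1 - e3) * (h * N1)) <= c0 * ((1 - e3) * (B + C1 * E)).
  by rewrite ler_wpM2l// ler_wpM2l// subr_ge0 ltW.
have h10 : 0 <= c0 * (e3 * (C1 * E)) by rewrite !mulr_ge0// ltW.
have h11 : 0 <= e * h by rewrite mulr_ge0// ltW.
move: h1 h2 h3 h4 h5 h6 h7 h8 h9 h10 h11 AN; clear; lra.
Qed.

(** The neighbourhood of [s] is independent of [x], and [r] is any bound on the [F1]-distance;
    increments of the length function take its place later. *)
Lemma dist_infinitesimal_le (F F1 : M -> vec -> R) (c0 : R) i (gamma : R -> M) s w e :
  finsler_structure F -> finsler_structure F1 -> 0 <= c0 -> 0 < e ->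
  gamma u @[u --> s] --> gamma s -> dom i (gamma s) ->
  is_derive s 1 (chart i \o gamma) w ->
  F (gamma s) (tvec i (gamma s) w) <= c0 * F1 (gamma s) (tvec i (gamma s) w) ->
  \forall u \near s, s < u -> forall x r,
    (dist F1 (gamma s) (gamma u) <= r%:E)%E ->
    (dist F x (gamma u) <= dist F x (gamma s) + (c0 * r + e * (u - s))%:E)%E.
Proof.
move=> hF hF1 c00 e0 cg is_ dw NN1; set q := gamma s in cg is_ NN1 *.
have lF := finsler_lagrangian hF; have lF1 := finsler_lagrangian hF1.
have [C C0 /nbhs_singleton HC] := lagrangian_upper lF is_.
have [C1 C10 /nbhs_singleton HC1] := lagrangian_upper lF1 is_.
set N := F q (tvec i q w) in NN1; set N1 := F1 q (tvec i q w) in NN1.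
have N10 : 0 <= N1 by exact: lagrangian_ge0 lF1 _ _ (tangent_tvec w is_).
have cN0 : 0 <= c0 * N1 by exact: mulr_ge0.
have CC0 : 0 <= C + c0 * C1 by rewrite addr_ge0 ?mulr_ge0// ltW.
(* Each [+ 1] keeps a denominator positive. The cap 1 on [e2] bounds the remainder by the time step,
   and the cap [1 / 2] keeps [e3 < 1], as [dist_ge_finsler] requires. *)
pose e1 := e / (4 * (`|w| + 1)).
pose e2 := Num.min 1 (e / (4 * (C + c0 * C1 + 1))).
pose e3 := Num.min (1 / 2) (e / (4 * (c0 * N1 + 1))).
have w0 : 0 < `|w| + 1 by rewrite ltr_wpDl.
have e10 : 0 < e1 by rewrite divr_gt0// mulr_gt0.
have e20 : 0 < e2 by rewrite lt_min ltr01 divr_gt0// mulr_gt0// ltr_wpDl.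
have e30 : 0 < e3 by rewrite lt_min divr_gt0//= divr_gt0// mulr_gt0// ltr_wpDl.
have e31 : e3 < 1 by rewrite gt_min; apply/orP; left; move: e0; clear; lra.
have e21 : e2 <= 1 by rewrite ge_min lexx.
have scale (z y : R) : 0 <= z -> y <= e / (4 * (z + 1)) -> 0 <= y -> y * z <= e / 4.
  move=> z0 yz y0; have z10 : 0 < z + 1 by rewrite ltr_wpDl.
  have : y * (z + 1) <= e / 4.
    by move: yz; rewrite ler_pdivlMr ?mulr_gt0//; clear; lra.
  by apply: le_trans; rewrite ler_wpM2l// lerDl.
have e1W : e1 * (`|w| + 1) <= e / 4.
  by rewrite /e1 invfM mulrA -mulrA mulVf ?mulr1// gt_eqF.
have e2C : e2 * (C + c0 * C1) <= e / 4.
  by apply: scale => //; [rewrite ge_min lexx orbT|exact: ltW].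
have e3N : e3 * (c0 * N1) <= e / 4.
  by apply: scale => //; [rewrite ge_min lexx orbT|exact: ltW].
have E1 := cg _ (dist_extend_near lF is_ e10).
have e3b : 0 < e3 < 1 by rewrite e30.
have E2 := cg _ (dist_ge_finsler hF1 is_ e3b).
have E3 := is_derive_near dw e20.
near=> u => su x r Hr.
have H1 : (dist F x (gamma u) <= dist F x q +
    (F q (tvec i q (chart i (gamma u) - chart i q)) +
     e1 * `|chart i (gamma u) - chart i q|)%:E)%E.
  by move: x {Hr}; near: u; exact: E1.
have H2 : (((1 - e3) * F1 q (tvec i q (chart i (gamma u) - chart i q)))%:E
    <= dist F1 q (gamma u))%E by near: u; exact: E2.
have H3 : `|chart i (gamma u) - chart i q - (u - s) *: w| <= e2 * `|u - s|.
  by near: u; exact: E3.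
have us0 : 0 < u - s by rewrite subr_gt0.
rewrite (gtr0_norm us0) in H3.
apply: le_trans H1 _; apply: leeD => //; rewrite lee_fin.
have {}H2 := le_trans H2 Hr; rewrite lee_fin in H2.
set D := chart i (gamma u) - chart i q in H2 H3 *.
apply: (infinitesimal_estimate c00 e0 N10 NN1 us0 C0 C10 (normr_ge0 w) e10 e1W
  e20 e21 e2C e30 e31 e3N (normr_ge0 _) H3 _ _ _ H2).
- have -> : D = (u - s) *: w + (D - (u - s) *: w) by rewrite addrC subrK.
  apply: le_trans (ler_normD _ _) _; rewrite normrZ (gtr0_norm us0).
  by rewrite [_ + (D - _)]addrC subrK.
- have -> : (u - s) * N = F q (tvec i q ((u - s) *: w)).
    by rewrite tvecZ (finsler_homogeneous hF (ltW us0) (tangent_tvec w is_)).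
  exact: finsler_perturb.
have -> : (u - s) * N1 = F1 q (tvec i q ((u - s) *: w)).
  by rewrite tvecZ (finsler_homogeneous hF1 (ltW us0) (tangent_tvec w is_)).
by rewrite distrC; exact: finsler_perturb.
Unshelve. all: by end_near. Qed.

End InfinitesimalComparison.

(** * Integrating the comparison along the path *)

Section Comparison.
Context (R : realType) (n : nat) (M : smoothManifold R n).
Local Notation vec := (chart_index M -> 'rV[R]_n).
Context (F F1 : M -> vec -> R) (c0 : R) (gamma : R -> M) (V : R -> R).
Hypothesis hF : finsler_structure F.
Hypothesis hF1 : finsler_structure F1.
Hypothesis c0_ge0 : 0 <= c0.
Hypothesis gamma_continuous : {within `[0, 1], continuous gamma}.
Hypothesis gamma_ac : absolutely_continuous 0 1 gamma.
Hypothesis V_ge : forall s u, 0 <= s -> s <= u -> u <= 1 ->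
  (dist F1 (gamma s) (gamma u) <= (V u - V s)%:E)%E.
Hypothesis velocity_le : {ae @lebesgue_measure R, forall s, 0 <= s <= 1 ->
  F (gamma s) (velocity gamma s) <= c0 * F1 (gamma s) (velocity gamma s)}.

Let V_nondecreasing s u : 0 <= s -> s <= u -> u <= 1 -> V s <= V u.
Proof.
move=> s0 su u1; rewrite -subr_ge0 -lee_fin.
exact: le_trans (dist_ge0 _ _ (finsler_lagrangian hF1)) (V_ge s0 su u1).
Qed.

(** The interval may lie on either side of [s0], to serve both steps of real induction, and [x] may
    be far from the chart, since the estimate is to be added to one for an earlier part of the
    path. *)
Lemma dist_path_le_local s0 : 0 <= s0 <= 1 -> exists2 d, 0 < d &
  forall a b x, 0 <= a -> a <= b -> b <= 1 -> s0 - d < a -> b < s0 + d ->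
    (dist F x (gamma b) <= dist F x (gamma a) + (c0 * (V b - V a))%:E)%E.
Proof.
move=> s01; have [i ip] := chart_exists (gamma s0).
have lF := finsler_lagrangian hF.
have [C [r1 [C0 r10 ext]]] := dist_extend_ball lF ip.
have [r2 r20 coordac] := abs_cont_coord gamma_ac ip.
have nball : nbhs (gamma s0)
    (chart_ball i (gamma s0) r1 `&` chart_ball i (gamma s0) r2).
  exact: filterI (chart_ball_nbhs ip r10) (chart_ball_nbhs ip r20).
have cgamma := (within_continuousP _ _).1 gamma_continuous.
have [|d d0 Hd] := cgamma s0 _ _ nball; first by rewrite /= in_itv.
exists d => // a b x a0 ab b1 da bd.
have ball s : a <= s <= b ->
    chart_ball i (gamma s0) r1 (gamma s) /\ chart_ball i (gamma s0) r2 (gamma s).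
  move=> sab; apply: Hd.
    by rewrite /= in_itv /=; move: sab a0 b1; lra.
  by rewrite ltr_norml; move: sab da bd; lra.
pose phi s := chart i (gamma s).
pose fc k := (fun s => phi s 0 k) \o clip a b.
have acf k : abs_cont (fc k) by apply: coordac => // s /ball[].
(* The weights are the norms of the basis vectors, so the increments of [v] dominate [C] times the
   norm of those of the coordinate path, hence the increments of the distance. *)
pose v s := C * \sum_k `|delta_mx 0 k : 'rV[R]_n| * variation_function (fc k) a s.
have acv : abs_cont v.
  apply: abs_contZ; apply: abs_cont_sum => k; apply: abs_contZ.
  exact: abs_cont_variation_function.
have ndv : nondecreasing v.
  move=> s u su; rewrite /v ler_pM2l//; apply: ler_sum => k _.
  by apply: ler_wpM2l => //; exact: variation_function_nondecreasing.
have phi_le s u : a <= s -> s <= u -> u <= b -> C * `|phi u - phi s| <= v u - v s.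
  move=> a_s su ub; rewrite /v -mulrBr ler_pM2l// -sumrB.
  apply: le_trans (norm_le_sum_coord _) _; apply: ler_sum => k _.
  rewrite -mulrBr ler_wpM2l//.
  have := variation_function_ge (acf k) a_s su.
  rewrite /fc /= !clip_id ?a_s ?ub ?(le_trans su)// ?(le_trans a_s)//.
  by rewrite !mxE.
have step s u y : a <= s <= b -> a <= u <= b ->
    (dist F y (gamma u) <= dist F y (gamma s) + (C * `|phi u - phi s|)%:E)%E.
  by move=> sab uab; apply: ext; [exact: (ball s sab).1|exact: (ball u uab).1].
(* Finiteness is not known beforehand: either the right-hand side is infinite, or it spreads from
   [a] to [[a, b]] by [step]. *)
have [->|fin_a] := eqVneq (dist F x (gamma a)) +oo%E; first by rewrite addye// leey.
have aab : a <= a <= b by rewrite lexx.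
have fin s : a <= s <= b -> dist F x (gamma s) \is a fin_num.
  move=> sab; rewrite ge0_fin_numE ?dist_ge0//.
  apply: le_lt_trans (step a s x aab sab) _.
  by rewrite lte_add_pinfty ?ltry// ltey.
pose D s := fine (dist F x (gamma s)).
have DE s : a <= s <= b -> dist F x (gamma s) = (D s)%:E by move=> /fin/fineK.
have bab : a <= b <= b by rewrite ab lexx.
suff : D b - D a <= c0 * V b - c0 * V a.
  by rewrite (DE _ aab) (DE _ bab) -EFinD lee_fin mulrBr; lra.
apply: (dini_le_ae (v := v) (V := fun s => c0 * V s)) => //.
- move=> s u a_s su ub; apply: ler_wpM2l => //; apply: V_nondecreasing => //.
    exact: le_trans a_s.
  exact: le_trans b1.
- move=> s u a_s su ub; apply: le_trans (phi_le s u a_s su ub).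
  have sab : a <= s <= b by rewrite a_s (le_trans su).
  have uab : a <= u <= b by rewrite ub (le_trans a_s).
  have := step s u x sab uab.
  by rewrite (DE _ sab) (DE _ uab) -EFinD lee_fin lerBlDl.
have aeF := ae_filter_ringOfSetsType (@lebesgue_measure R).
have aederiv : {ae @lebesgue_measure R, forall s, forall k,
    a < s < b -> derivable (fc k) s 1}.
  by apply: filter_forall => k; exact: derivable_ae_of_abs_cont.
apply: filterS2 velocity_le aederiv => s Hvel Hder sab e e0.
have sab' : a <= s <= b by move: sab; lra.
have s01' : 0 <= s <= 1 by move: sab a0 b1; lra.
have nab : \forall u \near s, a < u < b.
  by apply: near_in_itvoo; rewrite in_itv.
have is_ : dom i (gamma s) by have [[]] := ball s sab'.
have cs : gamma u @[u --> s] --> gamma s.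
  move=> A sA; have [|d1 d10 H1] := cgamma s _ A sA; first by rewrite /= in_itv.
  apply: filterS2 nab (nbhsx_ballx s d1 d10) => u uab su.
  by apply: H1 => //; rewrite /= in_itv /=; move: uab a0 b1; lra.
have dphi : derivable (chart i \o gamma) s 1.
  apply/derivable_mxP => j k; rewrite ord1; apply: near_eq_derivable (Hder k sab).
  apply: filterS nab => u uab; rewrite /fc /= clip_id//.
  by move: uab; lra.
have dw := derivableP dphi.
have nis : \forall u \near s, dom i (gamma u) := cs _ (nbhs_dom is_).
have := Hvel s01'; rewrite (velocity_tvec is_ nis dw) => NN1.
have /nbhs_ballP[d1 /= d10 H1] :=
  dist_infinitesimal_le hF hF1 c0_ge0 e0 cs is_ dw NN1.
exists d1 => // u /andP[su ud] ub.
have uab : a <= u <= b by rewrite ub andbT; move: sab su; lra.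
have bsu : `|s - u| < d1 by rewrite ltr_norml; move: su ud d10; lra.
have Vsu : (dist F1 (gamma s) (gamma u) <= (V u - V s)%:E)%E.
  by apply: V_ge; [case/andP: s01'|exact: ltW|exact: le_trans b1].
have := H1 u bsu su x _ Vsu.
rewrite (DE _ sab') (DE _ uab) -EFinD lee_fin mulrBr; lra.
Qed.

(** The base point [gamma a] stays fixed while the local increments accumulate. *)
Lemma dist_path_le a b : 0 <= a -> a <= b -> b <= 1 ->
  (dist F (gamma a) (gamma b) <= (c0 * (V b - V a))%:E)%E.
Proof.
move=> a0 ab b1; have lF := finsler_lagrangian hF.
pose P s : Prop := (dist F (gamma a) (gamma s) <= (c0 * (V s - V a))%:E)%E.
have trans s u : P s -> (dist F (gamma a) (gamma u) <=
    dist F (gamma a) (gamma s) + (c0 * (V u - V s))%:E)%E -> P u.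
  move=> Ps; move/le_trans; apply; apply: (le_trans (leeD Ps (lexx _))).
  by rewrite -EFinD lee_fin; lra.
apply: (@real_induction R a b P) => //.
- by rewrite /P subrr mulr0; exact: dist_self.
- move=> s /andP[a_s sb] Ps.
  have [|d d0 Hd] := @dist_path_le_local s.
    by move: a0 a_s sb b1; lra.
  exists d => // u /andP[su ud] ub; apply: trans Ps _; apply: Hd => //.
  + exact: le_trans a_s.
  + exact: ltW.
  + exact: le_trans b1.
  + by rewrite ltrBlDr ltrDl.
- move=> s /andP[a_s sb] IH.
  have [|d d0 Hd] := @dist_path_le_local s.
    by move: a0 a_s sb b1; lra.
  pose u := Num.max a (s - d / 2).
  have u1 : a <= u by rewrite le_max lexx.
  have u2 : s - d / 2 <= u by rewrite le_max lexx orbT.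
  have u3 : u < s by rewrite gt_max; move: a_s d0; lra.
  have Pu : P u by apply: IH; rewrite u1.
  apply: trans Pu _; apply: Hd.
  + exact: le_trans u1.
  + exact: ltW.
  + exact: le_trans b1.
  + by move: u2 d0; lra.
  + by rewrite ltrDl.
Qed.

End Comparison.

(** * Length with respect to a distance *)

Section MetricLength.
Context (R : realType) (n : nat) (M : smoothManifold R n).
Context (d : M -> M -> \bar R) (gamma : R -> M).
Hypothesis d_ge0 : forall x y, (0 <= d x y)%E.
Implicit Types (a b s u : R).

Lemma le_metric_length a b : a <= b ->
  (d (gamma a) (gamma b) <= metric_length d a b gamma)%E.
Proof.
move=> ab; apply: ereal_sup_ubound.
exists 0%N, (fun k => if k is 0%N then a else b); split=> //.
  by move=> k; rewrite leqn0 => /eqP ->.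
by rewrite big_nat1.
Qed.

Lemma metric_length_ge0 a b : a <= b -> (0 <= metric_length d a b gamma)%E.
Proof. by move=> /le_metric_length; apply: le_trans. Qed.

Lemma partition_sum_append a s u m (t : nat -> R) : t 0%N = a ->
  t m.+1 = s -> (forall k, (k <= m)%N -> t k <= t k.+1) -> s <= u ->
  (\sum_(0 <= k < m.+1) d (gamma (t k)) (gamma (t k.+1)) +
   d (gamma s) (gamma u) <= metric_length d a u gamma)%E.
Proof.
move=> t0 tm tle su; apply: ereal_sup_ubound.
exists m.+1, (fun k => if (k <= m.+1)%N then t k else u); split=> //.
- by rewrite ltnn.
- move=> k km1; have [->|kn] := eqVneq k m.+1; first by rewrite leqnn ltnn tm.
  have km : (k <= m)%N by rewrite -ltnS ltn_neqAle kn.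
  by rewrite km1 ltnS km; exact: tle.
rewrite [RHS]big_nat_recr//= leqnn ltnn tm; congr (_ + _)%E.
rewrite !big_nat; apply: eq_bigr => k /andP[_ km].
by rewrite (ltnW km) km.
Qed.

(** Appending [u] to a partition that ends at [s] makes length superadditive; finiteness at [b]
    passes down to all earlier parameters, so the values can be subtracted as reals. *)
Lemma metric_length_increment b : metric_length d 0%R b gamma \is a fin_num ->
  forall s u, 0 <= s -> s <= u -> u <= b ->
  (d (gamma s) (gamma u) <= (fine (metric_length d 0%R u gamma) -
                             fine (metric_length d 0%R s gamma))%:E)%E.
Proof.
move=> finb.
have step s u : 0 <= s -> s <= u -> metric_length d 0%R u gamma \is a fin_num ->
    [/\ metric_length d 0%R s gamma \is a fin_num,
        d (gamma s) (gamma u) \is a fin_num &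
        (metric_length d 0%R s gamma + d (gamma s) (gamma u) <=
         metric_length d 0%R u gamma)%E].
  move=> s0 su finu.
  have fd : d (gamma s) (gamma u) \is a fin_num.
    rewrite ge0_fin_numE//; apply: (@le_lt_trans _ _ (metric_length d 0%R u gamma)).
      have := @partition_sum_append 0 s u 0%N (fun k => if k is 0%N then 0 else s)
        erefl erefl _ su.
      rewrite big_nat1 => H; apply: le_trans (H _); first exact: leeDr.
      by move=> k; rewrite leqn0 => /eqP ->.
    by rewrite ltey_eq finu.
  have le : (metric_length d 0%R s gamma + d (gamma s) (gamma u) <=
      metric_length d 0%R u gamma)%E.
    rewrite -leeBrDr//; apply: ge_ereal_sup => _ [m [t [t0 tm tle ->]]].
    by rewrite leeBrDr//; exact: partition_sum_append.
  split=> //; rewrite ge0_fin_numE ?metric_length_ge0//.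
  apply: (@le_lt_trans _ _ (metric_length d 0%R u gamma)).
    by apply: le_trans le; exact: leeDl.
  by rewrite ltey_eq finu.
move=> s u s0 su ub.
have [finu _ _] := step u b (le_trans s0 su) ub finb.
have [fins finsu] := step s u s0 su finu.
rewrite -{1}(fineK fins) -{1}(fineK finu) -(fineK finsu) -EFinD !lee_fin.
by lra.
Qed.

End MetricLength.

(** * Conclusion for geodesics *)

Section GeodesicComparison.
Context (R : realType) (n : nat) (M : smoothManifold R n).
Local Notation vec := (chart_index M -> 'rV[R]_n).
Implicit Types (F G : M -> vec -> R) (x y : M) (gamma : R -> M).

Lemma partition_itv (t : nat -> R) m : (forall k, (k <= m)%N -> t k <= t k.+1) ->
  forall k, (k <= m.+1)%N -> t 0%N <= t k <= t m.+1.
Proof.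
move=> tle k km; apply/andP; split.
  elim: k km => // k IH km; apply: le_trans (IH (ltnW km)) _; exact: tle.
elim: m tle km => [|m IH] tle.
  by case: k => [|[|k]]// _; exact: tle.
rewrite leq_eqVlt => /predU1P[->//|]; rewrite ltnS => km.
apply: le_trans (tle _ (leqnn _)); apply: IH => // l lm.
by apply: tle; exact: leqW.
Qed.

(** Keeping [d] abstract between [c] times the distance of [F1] and the distance of [F] lets one
    statement serve both signs. The sums over partitions telescope to [c * (V 1 - V 0)], which by
    the geodesic property is at most [c] times the [F1]-distance of the end points, hence at most
    their [d]; this bounds the [d]-length and the [F]-distance alike. *)
Lemma geodesic_comparison F F1 (d : M -> M -> \bar R) (c : R) gamma :
  finsler_structure F -> finsler_structure F1 -> 0 <= c ->
  (forall x y, (d x y <= dist F x y)%E) ->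
  (forall x y, (c%:E * dist F1 x y <= d x y)%E) ->
  absolutely_continuous 0 1 gamma -> geodesic (dist F1) 0 1 gamma ->
  {ae @lebesgue_measure R, forall s, 0 <= s <= 1 ->
    F (gamma s) (velocity gamma s) <= c * F1 (gamma s) (velocity gamma s)} ->
  (dist F (gamma 0%R) (gamma 1%R) <= d (gamma 0%R) (gamma 1%R))%E /\
  geodesic d 0 1 gamma.
Proof.
move=> hF hF1 c0 dF F1d ac [cont lfin lE] ae.
have d1_ge0 x y : (0 <= dist F1 x y)%E.
  by apply: dist_ge0; exact: finsler_lagrangian.
have d_ge0 x y : (0 <= d x y)%E.
  by apply: le_trans (F1d x y); apply: mule_ge0 => //; rewrite lee_fin.
set L := metric_length (dist F1) 0 1 gamma in lfin lE *.
have finL : L \is a fin_num by rewrite ge0_fin_numE// metric_length_ge0.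
pose V s := fine (metric_length (dist F1) 0 s gamma).
have VL := metric_length_increment d1_ge0 finL.
have path_le := dist_path_le hF hF1 c0 cont ac VL ae.
have V0 : 0 <= V 0 by rewrite fine_ge0// metric_length_ge0.
have cV1 : ((c * (V 1 - V 0))%R%:E <= d (gamma 0%R) (gamma 1%R))%E.
  apply: le_trans (F1d _ _); rewrite -lE -(fineK finL) -EFinM lee_fin.
  by rewrite ler_wpM2l// lerBlDr lerDl.
have d_fin : (d (gamma 0%R) (gamma 1%R) < +oo)%E.
  apply: le_lt_trans (le_trans (dF _ _) (path_le 0 1 _ _ _)) (ltry _) => //.
have len_le : (metric_length d 0%R 1%R gamma <= d (gamma 0%R) (gamma 1%R))%E.
  apply: le_trans cV1; apply: ge_ereal_sup => _ [m [t [t0 tm tle ->]]].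
  have tk := partition_itv tle.
  have -> : (c * (V 1 - V 0))%R%:E =
      (\sum_(0 <= k < m.+1) (c * (V (t k.+1) - V (t k)))%:E)%E.
    by rewrite sumEFin -mulr_sumr telescope_sumr// t0 tm.
  rewrite !big_nat; apply: lee_sum => k /andP[_ km].
  have /andP[t0k tkm] := tk k (leqW km); have /andP[_ tkm1] := tk k.+1 km.
  apply: le_trans (dF _ _) (path_le _ _ _ _ _).
  - by rewrite -t0.
  - exact: tle.
  - by rewrite -tm.
split; first by apply: le_trans (path_le 0 1 _ _ _) cV1.
split=> //; first exact: le_lt_trans len_le d_fin.
by apply/eqP; rewrite eq_le len_le le_metric_length.
Qed.

End GeodesicComparison.

Theorem theorem5p4 (R : realType) (n : nat) (M : smoothManifold R n)
    (F1 F2 : M -> (chart_index M -> 'rV[R]_n) -> R) (t : R)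
    (gamma : M -> M -> R -> M)
    (hF1 : finsler_structure F1) (hF2 : finsler_structure F2)
    (ht : 0 <= t <= 1)
    (gamma_ac : forall x y, absolutely_continuous 0 1 (gamma x y))
    (gamma_join : forall x y, gamma x y 0 = x /\ gamma x y 1 = y)
    (gamma_geodesic : forall x y,
      geodesic (dist F1) 0 1 (gamma x y) /\ geodesic (dist F2) 0 1 (gamma x y))
    (gamma_sign : forall x y,
      let h s := (1 - t) * F1 (gamma x y s) (velocity (gamma x y) s)
                 - t * F2 (gamma x y s) (velocity (gamma x y) s) in
      {ae lebesgue_measure, forall s : R, 0 <= s <= 1 -> 0 <= h s} \/
      {ae lebesgue_measure, forall s : R, 0 <= s <= 1 -> h s <= 0}) :
  finsler_metric_with_lagrangian
    (max_metric t (dist F1) (dist F2)) (max_lagrangian t F1 F2) /\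
  forall x y, geodesic (max_metric t (dist F1) (dist F2)) 0 1 (gamma x y).
Proof.
have hF := finsler_max ht hF1 hF2; have /andP[t0 t1] := ht.
have t1' : 0 <= 1 - t by rewrite subr_ge0.
have [lF1 lF2] := (finsler_lagrangian hF1, finsler_lagrangian hF2).
have lF := finsler_lagrangian hF.
have max_le x y : (max_metric t (dist F1) (dist F2) x y <=
    dist (max_lagrangian t F1 F2) x y)%E.
  rewrite /max_metric ge_max; apply/andP; split.
    apply: dist_scale_le => // p v _; by rewrite /max_lagrangian le_max lexx.
  by apply: dist_scale_le => // p v _; rewrite /max_lagrangian le_max lexx orbT.
suff H x y : (dist (max_lagrangian t F1 F2) x y <=
    max_metric t (dist F1) (dist F2) x y)%E /\
    geodesic (max_metric t (dist F1) (dist F2)) 0 1 (gamma x y).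
  split=> [|x y]; last exact: (H x y).2.
  by split=> // x y; apply/eqP; rewrite eq_le max_le (H x y).1.
have [gamma0 gamma1] := gamma_join x y.
have [geo1 geo2] := gamma_geodesic x y.
have aeF := ae_filter_ringOfSetsType (@lebesgue_measure R).
suff : (dist (max_lagrangian t F1 F2) (gamma x y 0%R) (gamma x y 1%R) <=
    max_metric t (dist F1) (dist F2) (gamma x y 0%R) (gamma x y 1%R))%E /\
    geodesic (max_metric t (dist F1) (dist F2)) 0 1 (gamma x y).
  by rewrite gamma0 gamma1.
(* The sign decides which term realises the maximum along the path, hence which of the two geodesic
   properties is used. *)
have [sign|sign] := gamma_sign x y.
  apply: (geodesic_comparison hF hF1 t1' max_le) => //.
    by move=> p q; rewrite /max_metric le_max lexx.
  apply: filterS sign => s Hs s01; rewrite /max_lagrangian ge_max lexx /=.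
  by rewrite -subr_ge0; exact: Hs.
apply: (geodesic_comparison hF hF2 t0 max_le) => //.
  by move=> p q; rewrite /max_metric le_max lexx orbT.
apply: filterS sign => s Hs s01; rewrite /max_lagrangian ge_max lexx andbT.
by rewrite -subr_le0; exact: Hs.
Qed.
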